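(* Let $\mu$ be any dominant coweight of the root system $R^{[\Theta]}$ of $\mathrm{GSp}_{2n}$. Then $$\mathrm{Adm}^\Theta(\mu)=\mathrm{Perm}(\mu)\cap\widetilde W(\mathrm{GSp}_{2n}),$$ where $\mathrm{Adm}^\Theta(\mu)\subset\widetilde W(\mathrm{GSp}_{2n})$ is the admissible set for $\mathrm{GSp}_{2n}$ and $\mathrm{Perm}(\mu)\subset\widetilde W(\mathrm{GL}_{2n})$ is the permissible set for $\mathrm{GL}_{2n}$.
   Context: $\mathrm{GL}_{2n}$: let $X_*(\mathrm{GL}_{2n})=\mathbb Z^{2n}$, with roots $z\mapsto z_i-z_j$ ($i\ne j$), simple roots $z_i-z_{i+1}$ ($1\le i<2n$), and Weyl group $S_{2n}$ permuting coordinates. $\widetilde W(\mathrm{GL}_{2n})=\mathbb Z^{2n}\rtimes S_{2n}$ acts on $\mathbb R^{2n}$ by affine transformations ($\lambda$ acting as the translation $t_\lambda$); $W_{\rm aff}(\mathrm{GL}_{2n})$ is the subgroup $\{\lambda\in\mathbb Z^{2n}:\sum\lambda_i=0\}\rtimes S_{2n}$. The vertices of the base alcove are represented (modulo $\mathbb R(1,\dots,1)$) by $\omega_i=(1^i,0^{2n-i})$, $0\le i\le 2n-1$. For $\mu\in\mathbb Z^{2n}$ dominant, $\mathrm{Perm}(\mu)$ is the set of $x\in\widetilde W(\mathrm{GL}_{2n})$ lying in the same $W_{\rm aff}(\mathrm{GL}_{2n})$-coset as $t_\mu$ and such that $x(\omega_i)-\omega_i$ lies in the convex hull of $S_{2n}(\mu)$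 for all $0\le i\le2n-1$. $\mathrm{GSp}_{2n}$: let $\Theta(z_1,\dots,z_{2n})=(-z_{2n},\dots,-z_1)$, an automorphism of the root system of $\mathrm{GL}_{2n}$; its fixed-point root system $R^{[\Theta]}$ is the root system of $\mathrm{GSp}_{2n}$, described as follows. For $1\le i\le 2n$ put $\bar i=2n+1-i$. Coweight lattice: $X_*=\{z\in\mathbb Z^{2n}: z_i+z_{\bar i}\text{ independent of }i\}$, $V=X_*\otimes\mathbb R\subset\mathbb R^{2n}$, $X^*=\mathrm{Hom}(X_*,\mathbb Z)$, pairing $\langle\ ,\ \rangle$. Roots: the restrictions to $X_*$ of $z\mapsto z_i-z_j$, $i\ne j$; the corresponding coroot is $e_i-e_j+e_{\bar j}-e_{\bar i}$ if $j\ne\bar i$ and $e_i-e_{\bar i}$ if $j=\bar i$. Simple roots $\Pi$: the restrictions of $z_i-z_{i+1}$, $1\le i\le n$; highest root $\tilde\alpha=z_1-z_{2n}$. Finite Weyl group $W_0$: permutations $\sigma\in S_{2n}$ with $\sigma(\bar i)=\overline{\sigma(i)}$. A coweight $\mu\in X_*$ is dominant if $\langle\alpha,\mu\rangle\ge0$ for all $\alpha\in\Pi$, i.e. $\mu_1\ge\dots\ge\mu_{2n}$. $\widetilde W(\mathrm{GSp}_{2n})=X_*\rtimes W_0$, a subgroup of $\widetilde W(\mathrm{GL}_{2n})$. For a root $\alpha$ and $k\in\mathbb Z$ let $s_{\alpha,k}(x)=x-(\langle\alpha,x\rangle-k)\check\alpha$ on $V$, $s_\alpha=s_{\alpha,0}$.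 $W_{\rm aff}(\mathrm{GSp}_{2n})$ is generated by all $s_{\alpha,k}$ and is a Coxeter group with generators $S_{\rm aff}=\{s_\alpha:\alpha\in\Pi\}\cup\{s_{\tilde\alpha,1}\}$. Let $\Omega$ be the stabilizer in $\widetilde W(\mathrm{GSp}_{2n})$ of the base alcove $\{x\in V:\langle\alpha,x\rangle>0\ \forall\alpha\in\Pi,\ \langle\tilde\alpha,x\rangle<1\}$; then $\widetilde W(\mathrm{GSp}_{2n})=W_{\rm aff}(\mathrm{GSp}_{2n})\rtimes\Omega$. Bruhat order: for $w,w'\in W_{\rm aff}(\mathrm{GSp}_{2n})$, $\tau,\tau'\in\Omega$, $w\tau\le w'\tau'$ iff $\tau=\tau'$ and $w\le w'$ in the Bruhat order of the Coxeter group. Then $\mathrm{Adm}^\Theta(\mu)=\{x\in\widetilde W(\mathrm{GSp}_{2n}):x\le t_\lambda\text{ for some }\lambda\in W_0(\mu)\}$. *)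

(* Defs.v *)
From HB Require Import structures.
From Stdlib Require Import Relation_Operators.
From mathcomp Require Import all_boot all_order all_algebra all_fingroup.
From mathcomp Require Import boolp classical_sets reals convex.

Set Implicit Arguments.
Unset Strict Implicit.
Unset Printing Implicit Defensive.

Import Order.TTheory GRing.Theory Num.Theory.
Local Open Scope classical_set_scope.
Local Open Scope ring_scope.

(* [ExtW l s] is t_l * s in Z^N x| S_N.  A permutation s acts on row vectors by
   [col_perm s], i.e. (s z)_i = z_(s i); since [perm] products apply the left
   factor first, this is a left action. *)
Record extW (N : nat) :=
  ExtW { transl : 'rV[int]_N; finpart : 'S_N }.

Section ExtWGroup.
Variable N : nat.
Implicit Types x y z : extW N.

Definition extW_to_pair x := (transl x, finpart x).
Definition extW_of_pair (p : 'rV[int]_N * 'S_N) := ExtW p.1 p.2.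
Fact extW_pairK : cancel extW_to_pair extW_of_pair. Proof. by case. Qed.

HB.instance Definition _ := Choice.copy (extW N) (can_type extW_pairK).

Definition extW_one := ExtW (0 : 'rV[int]_N) 1%g.
Definition extW_mul x y :=
  ExtW (transl x + col_perm (finpart x) (transl y)) (finpart x * finpart y)%g.
Definition extW_inv x :=
  ExtW (- col_perm (finpart x)^-1%g (transl x)) (finpart x)^-1%g.

Fact extW_mulA : associative extW_mul.
Proof.
move=> [l s] [m t] [k u]; congr ExtW => /=; last by rewrite mulgA.
by rewrite linearD /= col_permM addrA.
Qed.

Fact extW_mul1 : left_id extW_one extW_mul.
Proof. by move=> [l s]; congr ExtW; rewrite /= ?mul1g // col_perm1 add0r. Qed.

Fact extW_mulr1 : right_id extW_one extW_mul.
Proof. by move=> [l s]; congr ExtW; rewrite /= ?mulg1 // linear0 addr0. Qed.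

Fact extW_mulV : left_inverse extW_one extW_inv extW_mul.
Proof. by move=> [l s]; congr ExtW; rewrite /= ?mulVg // addNr. Qed.

Fact extW_mulrV : right_inverse extW_one extW_inv extW_mul.
Proof.
move=> [l s]; congr ExtW; rewrite /= ?mulgV //.
by rewrite linearN /= -col_permM mulgV col_perm1 addrN.
Qed.

HB.instance Definition _ := isGroup.Build (extW N)
  extW_mulA extW_mul1 extW_mulr1 extW_mulV extW_mulrV.

End ExtWGroup.

Definition translation (N : nat) (l : 'rV[int]_N) : extW N := ExtW l 1%g.

Definition realv (R : realType) (N : nat) (z : 'rV[int]_N) : 'rV[R]_N :=
  map_mx intr z.

Definition aff_act (R : realType) (N : nat) (x : extW N) (v : 'rV[R]_N) : 'rV[R]_N :=
  realv R (transl x) + col_perm (finpart x) v.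

Section Coxeter.
Variable G : groupType.
Implicit Types (S : set G) (u v w : G).
Local Open Scope group_scope.

Definition gen S : set G := smallest (fun H : set G => group_closed [in H]) S.

Definition expressible S (w : G) (k : nat) : Prop :=
  exists s : seq G, [/\ size s = k, {in s, forall a, S a} & w = \prod_(a <- s) a].

Definition has_length S (w : G) (k : nat) : Prop :=
  expressible S w k /\ forall j, expressible S w j -> (k <= j)%N.

Definition cox_reflection S : set G :=
  [set t | exists a u, [/\ S a, gen S u & t = u * a * u^-1]].

Definition bruhat_step S (u v : G) : Prop :=
  exists t k l, [/\ cox_reflection S t, v = u * t,
    has_length S u k, has_length S v l & (k < l)%N].

Definition bruhat S : G -> G -> Prop := clos_refl_trans G (bruhat_step S).

End Coxeter.

Section GL.
Variables (R : realType) (N : nat).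

Definition conv_hull (A : set 'rV[R]_N) : set 'rV[R]_N :=
  smallest (fun C => convex_set (C : set (convex_lmodType 'rV[R]_N))) A.

Definition WaffGL : set (extW N) :=
  [set x | \sum_i transl x 0 i = 0].

Definition omega (i : 'I_N) : 'rV[R]_N := \row_j (j < i)%N%:R.

Definition PermGL (mu : 'rV[int]_N) : set (extW N) :=
  [set x | WaffGL (x * (translation mu)^-1)%g /\
    forall i : 'I_N,
      conv_hull [set realv R (col_perm s mu) | s in [set: 'S_N]]
        (aff_act x (omega i) - omega i)].

End GL.

(* Indices are 0-based, so the involution i |-> 2n+1-i of {1..2n} is
   [rev_ord].  A root of GSp_2n is given by a pair (i, j) with i != j; the pairs
   (i, j) and (rev_ord j, rev_ord i) restrict to the same root and have the
   same coroot. *)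
Section GSp.
Variables (R : realType) (n : nat).
Let N := (2 * n)%N.

Definition Xstar : set 'rV[int]_N :=
  [set z | forall i j, z 0 i + z 0 (rev_ord i) = z 0 j + z 0 (rev_ord j)].

(* X_* (x) R, realised as the linear span of X_* in R^(2n) *)
Definition Vsp : set 'rV[R]_N :=
  smallest (fun H : set 'rV[R]_N => GRing.submod_closed [in H]) ((@realv R N) @` Xstar).

Definition root_pairing (K : zmodType) (i j : 'I_N) (z : 'rV[K]_N) : K :=
  z 0 i - z 0 j.

Definition coroot (i j : 'I_N) : 'rV[int]_N :=
  if j == rev_ord i then delta_mx 0 i - delta_mx 0 (rev_ord i)
  else delta_mx 0 i - delta_mx 0 j
       + delta_mx 0 (rev_ord j) - delta_mx 0 (rev_ord i).

Definition simple_root (i j : 'I_N) : Prop := (i < n)%N /\ j = i.+1 :> nat.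
Definition highest_root (i j : 'I_N) : Prop := i = 0%N :> nat /\ j = N.-1 :> nat.

Definition dominant (mu : 'rV[int]_N) : Prop :=
  forall i j, simple_root i j -> 0 <= root_pairing i j mu.

Definition W0 : set 'S_N := [set s | forall i, s (rev_ord i) = rev_ord (s i)].

Definition WGSp : set (extW N) := [set x | Xstar (transl x) /\ W0 (finpart x)].

(* x is the affine reflection s_(alpha, k), alpha being the root (i, j);
   elements of WGSp are determined by their action on Vsp *)
Definition is_affrefl (i j : 'I_N) (k : int) (x : extW N) : Prop :=
  WGSp x /\
  forall v, Vsp v ->
    aff_act x v = v - (root_pairing i j v - k%:~R) *: realv R (coroot i j).

Definition affine_reflections : set (extW N) :=
  [set x | exists (i j : 'I_N) (k : int), i != j /\ is_affrefl i j k x].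

Definition WaffGSp : set (extW N) := gen affine_reflections.

Definition Saff : set (extW N) :=
  [set x | (exists i j, simple_root i j /\ is_affrefl i j 0 x) \/
           (exists i j, highest_root i j /\ is_affrefl i j 1 x)].

Definition base_alcove : set 'rV[R]_N :=
  [set v | [/\ Vsp v,
    forall i j, simple_root i j -> 0 < root_pairing i j v &
    forall i j, highest_root i j -> root_pairing i j v < 1]].

Definition Omega : set (extW N) :=
  [set x | WGSp x /\ aff_act x @` base_alcove = base_alcove].

Definition bruhat_ext (x y : extW N) : Prop :=
  exists w w' t, [/\ WaffGSp w /\ WaffGSp w', Omega t,
    x = (w * t)%g, y = (w' * t)%g & bruhat Saff w w'].

Definition AdmGSp (mu : 'rV[int]_N) : set (extW N) :=
  [set x | WGSp x /\ exists2 s, W0 s & bruhat_ext x (translation (col_perm s mu))].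

End GSp.

Arguments WGSp n : clear implicits.

(* Main.v *)
(** The geometry is carried by the integers [pos x c], N times the coordinates
    of the image under x of an interior point of the base alcove, with N = 2n.
    Bruhat lengths are compared through the exchange property: multiplying by
    an affine reflection increases the length exactly when the base alcove and
    its image lie on the same side of the reflecting hyperplane.

    Adm is contained in Perm: if x and the base alcove lie on the same side of
    the hyperplane of a reflection r, then x(v) - v lies on the segment between
    rx(v) - v and its mirror image, for every vertex v of the base alcove.

    Perm is contained in Adm: a permissible x that is not t_lambda with lambda
    in the orbit of mu has a reflection r such that rx is above x and still
    permissible; as the distance from the base alcove grows and is bounded, one
    ends at some t_lambda.  Permissibility of x means that for every t the sum
    of the entries of x(omega_t) - omega_t over an index set J is at most the
    sum of the #|J| largest entries of mu.  The sets for which equality holds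
    at a given t are closed under union and intersection.  Let a be the
    coordinate maximizing the sum of the a-th entries over a period, among
    those not yet at their final value, and t0 the last index before the a-th
    entry of x(omega_t) rises.  Let D be the smallest tight set at t0 that
    contains a and the coordinates with final large values.  The reflection
    makes the a-th entry rise earlier, together with the last entry b of D that
    rises before it: D stays tight, and minimal, over the whole interval on
    which a gains 1 and b loses 1.  For GSp the mirror image of this change
    takes place simultaneously; the two are compatible because D and its dual
    are both tight where they overlap. *)
Require Import Defs.
From mathcomp Require Import all_boot all_order all_algebra all_fingroup.
From mathcomp Require Import boolp classical_sets reals.
From Stdlib Require Import Relation_Operators.
From mathcomp Require Import interval_inference convex.
From mathcomp Require Import zify ring lra.

Set Implicit Arguments.
Unset Strict Implicit.
Unset Printing Implicit Defensive.

Import Order.TTheory GRing.Theory Num.Theory.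
Local Open Scope classical_set_scope.
Local Open Scope ring_scope.

(** * Affine permutations in coordinates *)

Lemma small_mod (N : nat) (k f : int) : k * N%:Z + f = 0 -> 0 <= f < N%:Z -> k = 0 /\ f = 0.
Proof.
move=> h hf; have k0 : k = 0.
  have [k1|k1] := lerP k (-1); first by nia.
  have [k2|k2] := lerP 1 k; first by nia.
  by lia.
by split=> //; move: h; rewrite k0 mul0r add0r.
Qed.

Definition ceilz (N : nat) (m : int) : int := - ((- m) %/ N%:Z)%Z.

Section Ceil.
Variable N : nat.
Hypothesis N_gt0 : (0 < N)%N.

Lemma ceilzP m : N%:Z * ceilz N m - N%:Z < m <= N%:Z * ceilz N m.
Proof.
have h := divz_eq (- m) N%:Z.
have h0 : 0 <= (- m %% N%:Z)%Z by apply: modz_ge0; lia.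
have h1 : (- m %% N%:Z)%Z < N%:Z by apply: ltz_pmod; lia.
by rewrite /ceilz; apply/andP; split; nia.
Qed.

Lemma ceilz_eq m q : N%:Z * q - N%:Z < m <= N%:Z * q -> ceilz N m = q.
Proof. by move=> hq; have := ceilzP m; nia. Qed.

Lemma ceilz_shift m q : ceilz N (m + q * N%:Z) = ceilz N m + q.
Proof. by apply: ceilz_eq; have := ceilzP m; nia. Qed.

(** Negation turns the ceiling into minus the floor, and the floor of m / N is the ceiling of (m +
    1) / N, less one. *)
Lemma ceilzN m : ceilz N (- m) = 1 - ceilz N (m + 1).
Proof. by apply: ceilz_eq; have := ceilzP (m + 1); nia. Qed.

Lemma ceilz_le m p : m <= p -> ceilz N m <= ceilz N p.
Proof. by move=> mp; have := ceilzP m; have := ceilzP p; nia. Qed.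

Lemma ceilz_le0 m : - N%:Z < m <= 0 -> ceilz N m = 0.
Proof. by move=> h; apply: ceilz_eq; lia. Qed.

Lemma ceilz_gt0 m : 0 < m <= N%:Z -> ceilz N m = 1.
Proof. by move=> h; apply: ceilz_eq; lia. Qed.

End Ceil.

Section Positions.
Variable N : nat.
Implicit Types (x y : extW N) (a b c : 'I_N) (k : int).

(* N times the image under x of the interior point (0, -1/N, ..., -(N-1)/N) of
   the base alcove; its entries are pairwise distinct modulo N. *)
Definition pos x c : int := N%:Z * transl x 0 c - (finpart x c)%:Z.

(* The affine function z_a - z_b - k at that point, again scaled by N. *)
Definition wall x a b k : int := pos x a - pos x b - k * N%:Z.

Lemma translM x y c :
  transl (x * y)%g 0 c = transl x 0 c + transl y 0 (finpart x c).
Proof. by rewrite /= !mxE. Qed.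

Lemma finpartM x y c : finpart (x * y)%g c = finpart y (finpart x c).
Proof. by rewrite /= permM. Qed.

Lemma pos1 c : pos 1%g c = - (c : nat)%:Z.
Proof. by rewrite /pos /= mxE perm1 mulr0 add0r. Qed.

Lemma posM x y c : pos (x * y)%g c = N%:Z * transl x 0 c + pos y (finpart x c).
Proof. by rewrite /pos translM finpartM; ring. Qed.

Lemma wall1 a b k : wall 1%g a b k = b%:Z - a%:Z - k * N%:Z.
Proof. by rewrite /wall !pos1; ring. Qed.

Lemma wallM x y a b k :
  wall (x * y)%g a b k =
  wall y (finpart x a) (finpart x b) (k - transl x 0 a + transl x 0 b).
Proof. by rewrite /wall !posM; ring. Qed.

Lemma pos_inj_mod x a b k : pos x a = pos x b + k * N%:Z -> a = b.
Proof.
rewrite /pos => h; apply: (@perm_inj _ (finpart x)); apply: val_inj => /=.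
have := ltn_ord (finpart x a); have := ltn_ord (finpart x b).
move: (transl x 0 a) (transl x 0 b) (val (finpart x a)) (val (finpart x b)) h.
move=> l m u v h hu hv.
have e : l - m = k by nia.
by move: h; rewrite -e; nia.
Qed.

Lemma wall_neq0 x a b k : a != b -> wall x a b k != 0.
Proof.
move=> ab; apply: contra ab => /eqP h; apply/eqP.
by apply: (@pos_inj_mod x a b k); move: h; rewrite /wall; lia.
Qed.

Lemma extW_ext x y :
  (forall c, transl x 0 c = transl y 0 c) -> finpart x =1 finpart y -> x = y.
Proof.
by case: x y => [l s] [m t] /= /rowP -> /permP ->.
Qed.

End Positions.


(** * Symplectic reflections *)

Section SymplecticReflections.
Variable n : nat.
Local Notation N := (2 * n)%N.
Implicit Types (x y : extW N) (a b c i j : 'I_N) (k : int).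

Lemma rev_neq c : rev_ord c != c.
Proof. by apply/eqP => /(congr1 val) /= h; have := ltn_ord c; lia. Qed.

Lemma rev_eqC a b : (rev_ord a == b) = (a == rev_ord b).
Proof. by apply/eqP/eqP => [<-|->]; rewrite rev_ordK. Qed.

Lemma rev_eq a b : (rev_ord a == rev_ord b) = (a == b).
Proof. by rewrite (inj_eq rev_ord_inj). Qed.

Lemma corootE i j c :
  coroot i j 0 c = if j == rev_ord i then (c == i)%:Z - (c == j)%:Z else
    (c == i)%:Z - (c == j)%:Z + (c == rev_ord j)%:Z - (c == rev_ord i)%:Z.
Proof. by rewrite /coroot; case: eqP => [->|_]; rewrite !mxE !natz. Qed.

Lemma coroot_l i j : i != j -> coroot i j 0 i = 1.
Proof.
move=> ij; rewrite corootE eqxx (negbTE ij) -rev_eqC [i == rev_ord i]eq_sym.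
rewrite (negbTE (rev_neq i)) eq_sym.
by case: ifP; rewrite -1?rev_eqC => h; rewrite ?h.
Qed.

Lemma coroot_rev i j c : i != j -> coroot i j 0 (rev_ord c) = - coroot i j 0 c.
Proof.
move=> ij; rewrite !corootE !rev_eq !rev_eqC; case: eqP => [->|_]; last by lia.
by rewrite rev_ordK; lia.
Qed.

Lemma coroot_sym i j c : i != j -> coroot j i 0 c = - coroot i j 0 c.
Proof.
by move=> ij; rewrite !corootE -(rev_eqC i j) [rev_ord i == j]eq_sym; case: eqP => _; lia.
Qed.

Lemma coroot_r i j : i != j -> coroot i j 0 j = -1.
Proof. by move=> ij; rewrite -(opprK (coroot _ _ _ _)) -coroot_sym // coroot_l // eq_sym. Qed.

(* This permutation is the linear part of the reflection in the root (a, b). *)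
Definition rperm a b : 'S_N :=
  if b == rev_ord a then tperm a b
  else (tperm a b * tperm (rev_ord a) (rev_ord b))%g.

Variant rperm_spec a b c : 'I_N -> int -> Type :=
| RpermL of c = a : rperm_spec a b c b 1
| RpermR of c = b : rperm_spec a b c a (-1)
| RpermRL of b <> rev_ord a & c = rev_ord a :
    rperm_spec a b c (rev_ord b) (-1)
| RpermRR of b <> rev_ord a & c = rev_ord b :
    rperm_spec a b c (rev_ord a) 1
| RpermD of c <> a & c <> b & c <> rev_ord a & c <> rev_ord b :
    rperm_spec a b c c 0.

Lemma rpermP a b c : a != b -> rperm_spec a b c (rperm a b c) (coroot a b 0 c).
Proof.
move=> ab; rewrite corootE /rperm; have [e|e] := eqVneq b (rev_ord a).
  case: tpermP => [->|->|/eqP ca /eqP cb].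
  - by rewrite eqxx (negbTE ab); exact: RpermL.
  - by rewrite eqxx eq_sym (negbTE ab); exact: RpermR.
  by rewrite (negbTE ca) (negbTE cb) subrr; apply: RpermD;
    apply/eqP => //; rewrite -?e // e rev_ordK.
have ra : a != rev_ord a by rewrite eq_sym rev_neq.
have rb : b != rev_ord b by rewrite eq_sym rev_neq.
have e' : a != rev_ord b by rewrite -rev_eqC eq_sym.
have ne := elimN eqP e.
rewrite permM; case: (tpermP a b c) => [->|->|/eqP ca /eqP cb].
- have -> : tperm (rev_ord a) (rev_ord b) b = b by rewrite tpermD // eq_sym.
  rewrite eqxx (negbTE ab) (negbTE e') (negbTE ra); exact: RpermL.
- have -> : tperm (rev_ord a) (rev_ord b) a = a by rewrite tpermD // eq_sym.
  rewrite eqxx [b == a]eq_sym (negbTE ab) (negbTE rb) (negbTE e); exact: RpermR.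
rewrite (negbTE ca) (negbTE cb); case: tpermP => [e1|e1|/eqP cra /eqP crb].
- rewrite e1 !rev_eq (negbTE ab) eqxx; exact: RpermRL.
- rewrite e1 !rev_eq [b == a]eq_sym (negbTE ab) eqxx; exact: RpermRR.
by rewrite (negbTE cra) (negbTE crb); apply: RpermD; apply/eqP.
Qed.

(** The condition on z gives z (rev a) - z (rev b) = z b - z a, so one difference governs both
    exchanged pairs. K is general to serve integral positions and real vectors alike. *)
Lemma rperm_reflect (K : comPzRingType) (z : 'I_N -> K) a b c :
  a != b -> (forall i j, z i + z (rev_ord i) = z j + z (rev_ord j)) ->
  z (rperm a b c) = z c - (z a - z b) * (coroot a b 0 c)%:~R.
Proof.
move=> ab zs; have := zs a b => zab.
case: rpermP => // [->|->|_ ->|_ ->|_ _ _ _]; rewrite ?mulr0 ?subr0 //.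
- by rewrite mulr1; ring.
- by rewrite mulrN1; ring.
- by rewrite mulrN1 -[z (rev_ord b)](addKr (z b)) -zab; ring.
- by rewrite mulr1 -[z (rev_ord a)](addKr (z a)) zab; ring.
Qed.

Lemma rperm_l a b : rperm a b a = b.
Proof.
rewrite /rperm; case: eqP => [_|/eqP e]; first exact: tpermL.
rewrite permM tpermL tpermD //; first by rewrite eq_sym.
exact: rev_neq.
Qed.

Lemma rperm_r a b : rperm a b b = a.
Proof.
rewrite /rperm; case: eqP => [_|/eqP e]; first exact: tpermR.
rewrite permM tpermR tpermD //; first exact: rev_neq.
by rewrite rev_eqC.
Qed.

Lemma rperm_revl a b : rperm a b (rev_ord a) = rev_ord b.
Proof.
rewrite /rperm; case: eqP => [->|/eqP e]; first by rewrite tpermR rev_ordK.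
rewrite permM [tperm a b _]tpermD ?tpermL // eq_sym.
exact: rev_neq.
Qed.

Lemma rperm_d a b c :
  a != c -> b != c -> rev_ord a != c -> rev_ord b != c -> rperm a b c = c.
Proof.
by move=> h1 h2 h3 h4; rewrite /rperm; case: eqP => _; rewrite ?permM !tpermD.
Qed.

Lemma rperm_revr a b : rperm a b (rev_ord b) = rev_ord a.
Proof.
rewrite /rperm; case: eqP => [->|/eqP e]; first by rewrite rev_ordK tpermL.
rewrite permM [tperm a b _]tpermD ?tpermR // -rev_eqC ?rev_neq //.
by rewrite eq_sym.
Qed.

Lemma rperm_rev a b c : rperm a b (rev_ord c) = rev_ord (rperm a b c).
Proof.
have [->|ca] := eqVneq a c; first by rewrite rperm_l rperm_revl.
have [->|cb] := eqVneq b c; first by rewrite rperm_r rperm_revr.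
have [<-|cra] := eqVneq (rev_ord a) c; first by rewrite rperm_revl !rev_ordK rperm_l.
have [<-|crb] := eqVneq (rev_ord b) c; first by rewrite rperm_revr !rev_ordK rperm_r.
by rewrite !rperm_d // ?rev_eq // -?rev_eqC // rev_eqC.
Qed.

Lemma rpermK a b c : rperm a b (rperm a b c) = c.
Proof.
have [<-|ca] := eqVneq a c; first by rewrite rperm_l rperm_r.
have [<-|cb] := eqVneq b c; first by rewrite rperm_r rperm_l.
have [<-|cra] := eqVneq (rev_ord a) c; first by rewrite rperm_revl rperm_revr.
have [<-|crb] := eqVneq (rev_ord b) c; first by rewrite rperm_revr rperm_revl.
by rewrite !rperm_d.
Qed.

Lemma rpermJ (s : 'S_N) a b c : W0 s -> rperm (s a) (s b) (s c) = s (rperm a b c).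
Proof.
move=> sW.
have [<-|ca] := eqVneq a c; first by rewrite !rperm_l.
have [<-|cb] := eqVneq b c; first by rewrite !rperm_r.
have [<-|cra] := eqVneq (rev_ord a) c; first by rewrite sW !rperm_revl sW.
have [<-|crb] := eqVneq (rev_ord b) c; first by rewrite sW !rperm_revr sW.
by rewrite !rperm_d // -?sW (inj_eq perm_inj).
Qed.

Lemma corootJ (s : 'S_N) a b c :
  W0 s -> coroot (s a) (s b) 0 (s c) = coroot a b 0 c.
Proof. by move=> sW; rewrite !corootE -!sW !(inj_eq perm_inj). Qed.

Lemma rpermC a b : rperm a b = rperm b a.
Proof.
by rewrite /rperm -rev_eqC eq_sym (tpermC b a) (tpermC (rev_ord b)).
Qed.

Lemma rperm_mirror a b : rperm (rev_ord b) (rev_ord a) = rperm a b.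
Proof.
apply/permP => c.
have [<-|ca] := eqVneq a c; first by rewrite -{2}(rev_ordK a) rperm_revr rev_ordK rperm_l.
have [<-|cb] := eqVneq b c; first by rewrite -{2}(rev_ordK b) rperm_revl rev_ordK rperm_r.
have [<-|cra] := eqVneq (rev_ord a) c; first by rewrite rperm_r rperm_revl.
have [<-|crb] := eqVneq (rev_ord b) c; first by rewrite rperm_l rperm_revr.
by rewrite !rperm_d // ?rev_ordK.
Qed.

Lemma coroot_mirror a b c : coroot (rev_ord b) (rev_ord a) 0 c = coroot a b 0 c.
Proof.
rewrite !corootE !rev_ordK [rev_ord a == b]eq_sym.
by case: eqP => [->|_]; rewrite ?rev_ordK; lia.
Qed.

(** This is s_(alpha, k) for the root (a, b), split into translation and linear part; [is_affreflP]
    shows that no other element acts on V in this way. *)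
Definition refl a b k : extW N := ExtW (k *: coroot a b) (rperm a b).

Lemma translR a b k c : transl (refl a b k) 0 c = k * coroot a b 0 c.
Proof. by rewrite /= mxE. Qed.

Lemma WGSpM x y : WGSp n x -> WGSp n y -> WGSp n (x * y)%g.
Proof.
move=> [xX xW] [yX yW]; split=> [i j|i]; last by rewrite !finpartM xW yW.
by rewrite !translM !xW; have := xX i j; have := yX (finpart x i) (finpart x j); lia.
Qed.

Lemma WGSp1 : WGSp n 1%g.
Proof. by split=> [i j|i]; rewrite /= ?mxE // !perm1. Qed.

Lemma WGSpV x : WGSp n x -> WGSp n x^-1%g.
Proof.
move=> [xX xW].
have sV i : (finpart x)^-1%g (rev_ord i) = rev_ord ((finpart x)^-1%g i).
  by apply: (@perm_inj _ (finpart x)); rewrite xW !permKV.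
split=> [i j|i]; last exact: sV.
by rewrite /= !mxE !sV; have := xX ((finpart x)^-1%g i) ((finpart x)^-1%g j); lia.
Qed.

Lemma refl_WGSp a b k : a != b -> WGSp n (refl a b k).
Proof.
move=> ab; split=> [i j|i] /=; last exact: rperm_rev.
by rewrite !mxE !coroot_rev // !mulrN !addrN.
Qed.

Lemma pos_refl x a b k c : WGSp n x -> a != b ->
  pos (refl a b k * x)%g c = pos x c - wall x a b k * coroot a b 0 c.
Proof.
move=> [xX xW] ab; rewrite posM translR (rperm_reflect (z := pos x) c ab); last first.
  move=> i j; rewrite /pos; have := xX i j; rewrite !xW /=.
  have := ltn_ord (finpart x i); have := ltn_ord (finpart x j).
  by move: (transl _ _ _) (transl _ _ _) (transl _ _ _) (transl _ _ _); nia.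
by rewrite /wall intz; ring.
Qed.

Lemma reflK a b k : a != b -> (refl a b k * refl a b k = 1)%g.
Proof.
move=> ab; apply: extW_ext => c; last by rewrite finpartM /= rpermK perm1.
rewrite translM !translR (rperm_reflect (z := fun c => coroot a b 0 c) c ab).
  by rewrite coroot_l // coroot_r // /= !mxE intz; ring.
by move=> i j; rewrite !coroot_rev // !subrr.
Qed.

Lemma refl_conj x a b k : WGSp n x -> a != b ->
  (x * refl (finpart x a) (finpart x b) (k - transl x 0 a + transl x 0 b)
   = refl a b k * x)%g.
Proof.
move=> [xX xW] ab; apply: extW_ext => c; last by rewrite !finpartM /= rpermJ.
rewrite !translM !translR /= corootJ // (rperm_reflect (z := fun c => transl x 0 c) c ab) //.
by rewrite intz; ring.
Qed.

End SymplecticReflections.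

(** * Walls and the exchange property *)

Section Generated.
Variables (G : groupType) (S : set G).
Implicit Types (x y : G) (H : set G).

Lemma gen_in x : S x -> gen S x.
Proof. exact: sub_gen_smallest. Qed.

Lemma gen_closed : group_closed [in gen S].
Proof.
split; first by rewrite inE => H [[+ _] _]; rewrite inE.
move=> x y; rewrite !inE => xS yS H [HG HS].
have /= := HG.2 x y; rewrite !inE; apply; [exact: xS|exact: yS].
Qed.

Lemma gen1 : gen S 1%g.
Proof. by have := gen_closed.1; rewrite inE. Qed.

Lemma genM x y : gen S x -> gen S y -> gen S (x * y)%g.
Proof.
by move=> xS yS; have := group_closedM gen_closed (x := x) (y := y); rewrite !inE; apply.
Qed.

Lemma genV x : gen S x -> gen S x^-1%g.
Proof.
by move=> xS; have := group_closedV gen_closed (x := x); rewrite !inE; apply.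
Qed.

Lemma gen_prod (s : seq G) :
  {in s, forall a, S a} -> gen S (\prod_(a <- s) a)%g.
Proof.
move=> sS; rewrite big_seq; elim/big_ind: _ => [|x y|x xs]; first exact: gen1.
  exact: genM.
by apply: gen_in; apply: sS.
Qed.

Lemma gen_min H :
  group_closed [in H] -> S `<=` H -> gen S `<=` H.
Proof. exact: smallest_sub. Qed.

End Generated.

(** * Crossing walls and deleting letters *)

Section Walls.
Variable n : nat.
Local Notation N := (2 * n)%N.
Implicit Types (x y : extW N) (a b c i j : 'I_N) (k : int).

(** The pairs (a, b) and (rev b, rev a) contribute equally, and they are the same pair when b = rev
    a. *)
Lemma sum_coroot (z : 'I_N -> int) a b :
  (forall i j, z i + z (rev_ord i) = z j + z (rev_ord j)) ->
  \sum_c coroot a b 0 c * z c =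
  (if b == rev_ord a then 1 else 2) * (z a - z b).
Proof.
move=> zs.
have d e : \sum_c (c == e)%:Z * z c = z e.
  rewrite (bigD1 e) //= eqxx mul1r big1 ?addr0 // => c /negbTE ->.
  by rewrite mul0r.
under eq_bigr do rewrite corootE; case: eqP => e.
  under eq_bigr do rewrite mulrBl.
  by rewrite sumrB !d mul1r.
under eq_bigr do rewrite mulrBl mulrDl mulrBl.
by rewrite sumrB big_split sumrB /= !d; have := zs a b; lia.
Qed.

Lemma wall_refl x a b k : WGSp n x -> a != b ->
  wall (refl a b k * x)%g a b k = - wall x a b k.
Proof.
move=> xW ab; rewrite {1}/wall !pos_refl // coroot_l // coroot_r // /wall; ring.
Qed.

(* The squared distance between the images of the interior point under x
   and 1; crossing a wall changes it in the direction of the Bruhat order. *)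
Definition sqdist x : int := \sum_c (pos x c + (c : nat)%:Z) ^+ 2.

Lemma sqdist_ge0 x : 0 <= sqdist x.
Proof. by apply: sumr_ge0 => c _; apply: sqr_ge0. Qed.

Lemma pos_rev x i j : WGSp n x ->
  pos x i + pos x (rev_ord i) = pos x j + pos x (rev_ord j).
Proof.
move=> [xX xW]; rewrite /pos; have := xX i j; rewrite !xW /=.
have := ltn_ord (finpart x i); have := ltn_ord (finpart x j).
by move: (transl _ _ _) (transl _ _ _) (transl _ _ _) (transl _ _ _); nia.
Qed.

(** In the expansion of the square of T - w coroot, T a - T b is the difference of the wall values
    at x and at 1; the terms in w ^ 2 cancel and the product of the two values remains. *)
Lemma sqdist_refl x a b k : WGSp n x -> a != b ->
  exists2 m : int, 0 < m &
    sqdist (refl a b k * x)%g = sqdist x + m * (wall x a b k * wall 1%g a b k).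
Proof.
move=> xW ab; set w := wall x a b k; set T := fun c => pos x c + (c : nat)%:Z.
have Ts i j : T i + T (rev_ord i) = T j + T (rev_ord j).
  rewrite /T /=; have := pos_rev i j xW; have := ltn_ord i; have := ltn_ord j.
  by lia.
have Cs i j : coroot a b 0 i + coroot a b 0 (rev_ord i) =
    coroot a b 0 j + coroot a b 0 (rev_ord j).
  by rewrite !coroot_rev // !addrN.
exists (2 * (if b == rev_ord a then 1 else 2)); first by case: ifP.
have -> : sqdist (refl a b k * x)%g = \sum_c (T c ^+ 2 -
    2 * w * (coroot a b 0 c * T c) + w ^+ 2 * (coroot a b 0 c * coroot a b 0 c)).
  by apply: eq_bigr => c _; rewrite pos_refl // -/w /T; ring.
rewrite big_split sumrB /= -!mulr_sumr !sum_coroot // coroot_l // coroot_r //.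
rewrite /sqdist -/(T _) wall1 /w /wall /T; ring.
Qed.

Definition simple_wall i j k : Prop :=
  simple_root i j /\ k = 0 \/ highest_root i j /\ k = 1.

Definition simple_refls : set (extW N) :=
  [set x | exists i j k, simple_wall i j k /\ x = refl i j k].

Lemma simple_wallP i j k : simple_wall i j k ->
  i != j /\ (wall 1%g i j k = 1 \/ wall 1%g i j k = -1).
Proof.
rewrite wall1 => -[[[ilt ij] ->]|[[i0 jN] ->]].
  by split; [apply/eqP => h; move: ij; rewrite h; lia|left; rewrite ij; lia].
have := ltn_ord i; rewrite i0 jN => N0; split; last by right; lia.
by apply/eqP => h; move: i0; rewrite h jN; lia.
Qed.

Lemma refl_swap a b k : a != b -> refl b a (- k) = refl a b k.
Proof.
move=> ab; apply: extW_ext => c; last by rewrite /= rpermC.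
by rewrite !translR coroot_sym // mulrNN.
Qed.

Lemma refl_mirror a b k : refl (rev_ord b) (rev_ord a) k = refl a b k.
Proof.
apply: extW_ext => c; last by rewrite /= rperm_mirror.
by rewrite !translR coroot_mirror.
Qed.

Lemma eq_ord_mod a b k : b%:Z = a%:Z + k * N%:Z -> a = b /\ k = 0.
Proof.
have := ltn_ord a; have := ltn_ord b; move=> hb ha e.
have k0 : k = 0 by nia.
by split => //; apply: val_inj => /=; move: e; rewrite k0; lia.
Qed.

(** The entry 1 sits at i or rev j, the entry -1 at j or rev i. The matching choices represent the
    same root; a mixed choice would force j = rev i, excluded in those cases. *)
Lemma refl_of_coroot i j k0 a b k : i != j ->
  coroot i j 0 a = 1 -> coroot i j 0 b = -1 ->
  wall 1%g a b k = wall 1%g i j k0 -> refl a b k = refl i j k0.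
Proof.
move=> ij; rewrite !wall1.
case: (rpermP a ij) => // [->|ne ->] _; case: (rpermP b ij) => // [->|ji ->] _ /=.
- move=> e; have N0 := ltn_ord i; congr refl; nia.
- move=> e; have [/eqP] := @eq_ord_mod j (rev_ord i) (k - k0) ltac:(rewrite /=; lia).
  by move/eqP: ji => /negbTE ->.
- move=> e; have [/eqP] := @eq_ord_mod i (rev_ord j) (k0 - k) ltac:(rewrite /=; lia).
  by rewrite -rev_eqC => /eqP h; case: ne.
move=> e; have hi := ltn_ord i; have hj := ltn_ord j.
by rewrite refl_mirror; congr refl; nia.
Qed.

(* A simple reflection moves the base alcove across its own wall only. *)
Lemma simple_side i j k0 a b k : simple_wall i j k0 -> a != b ->
  (0 < wall (refl i j k0) a b k) != (0 < wall 1%g a b k) ->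
  refl a b k = refl i j k0.
Proof.
move=> /simple_wallP [ij u1] ab.
have w0 := wall_neq0 1%g k ab; have w0' := wall_neq0 (refl i j k0) k ab.
have e : wall (refl i j k0) a b k =
    wall 1%g a b k - wall 1%g i j k0 * (coroot i j 0 a - coroot i j 0 b).
  have h c := pos_refl k0 c (@WGSp1 n) ij; rewrite mulg1 in h.
  by move: (wall _ i j _) h => u h; rewrite /wall !h; ring.
have cc c : coroot i j 0 c = 1 \/ coroot i j 0 c = -1 \/ coroot i j 0 c = 0.
  by case: rpermP => // *; lia.
move=> d.
(* Both wall values are nonzero integers and differ by at most 2; a change of sign makes them 1 and
   -1, so the coroot entries at a and b are opposite units. *)
have [[ca [cb h]]|[ca [cb h]]] :
    (coroot i j 0 a = 1 /\ coroot i j 0 b = -1 /\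
     wall 1%g a b k = wall 1%g i j k0) \/
    (coroot i j 0 a = -1 /\ coroot i j 0 b = 1 /\
     wall 1%g a b k = - wall 1%g i j k0).
- by case: (cc a) (cc b) e d => [->|[->|->]] [->|[->|->]]; case: u1 => ->; lia.
- exact: refl_of_coroot.
rewrite -refl_swap //; apply: refl_of_coroot => //.
by move: h; rewrite !wall1; lia.
Qed.

Lemma simple_reflsW x : simple_refls x -> WGSp n x.
Proof. by move=> [i [j [k [/simple_wallP [ij _] ->]]]]; apply: refl_WGSp. Qed.

Lemma gen_expressible x : gen simple_refls x -> exists m, expressible simple_refls x m.
Proof.
apply: (gen_min (H := [set x | exists m, expressible simple_refls x m])) => [|s sS]; last first.
  by exists 1%N, [:: s]; split=> // [t|]; rewrite ?big_seq1 // inE => /eqP ->.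
split; first by rewrite inE; exists 0%N, [::]; rewrite big_nil.
move=> u v; rewrite !inE => -[l [s [_ sS ->]]] [m [t [_ tS ->]]] /=.
exists (size s + size t)%N, (s ++ rev t); split; first by rewrite size_cat size_rev.
  by move=> r; rewrite mem_cat mem_rev => /orP [/sS|/tS].
rewrite big_cat /=; congr (_ * _)%g.
elim: t tS => [_|r t IH tS]; first by rewrite big_nil invg1.
have rS : simple_refls r by apply: tS; rewrite inE eqxx.
rewrite big_cons invgM IH; last by move=> z zt; apply: tS; rewrite inE zt orbT.
rewrite rev_cons -cats1 big_cat big_seq1 /=; congr (_ * _)%g.
case: rS => i [j [k [/simple_wallP [ij _] ->]]].
by apply: mulg1_eq; apply: reflK.
Qed.

Lemma gen_simple_WGSp x : gen simple_refls x -> WGSp n x.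
Proof.
apply: gen_min; last exact: simple_reflsW.
split; first by rewrite inE; apply: WGSp1.
move=> u v; rewrite !inE => uW vW.
by apply: WGSpM => //; apply: WGSpV.
Qed.

(* If the wall of refl a b k separates the base alcove from its image under
   a word, the corresponding gallery crosses it, which exhibits a letter to
   delete as well as a conjugate of a letter equal to the reflection. *)
Lemma strong_exchange (s : seq (extW N)) a b k :
  {in s, forall x, simple_refls x} -> a != b ->
  (0 < wall (\prod_(x <- s) x)%g a b k) != (0 < wall 1%g a b k) ->
  (exists s', [/\ {in s', forall x, simple_refls x}, size s = (size s').+1 &
     (refl a b k * \prod_(x <- s) x = \prod_(x <- s') x)%g]) /\
  cox_reflection simple_refls (refl a b k).
Proof.
elim: s a b k => [|x s IH] a b k sS ab; first by rewrite big_nil eqxx.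
have xS : simple_refls x by apply: sS; rewrite inE eqxx.
have {}sS : {in s, forall y, simple_refls y}.
  by move=> y ys; apply: sS; rewrite inE ys orbT.
have xx : (x * x = 1)%g.
  by case: xS => i [j [l [/simple_wallP [ij _] ->]]]; apply: reflK.
have xV : (x^-1 = x)%g by apply: mulg1_eq.
rewrite big_cons wallM => d.
(* If the first letter is the reflection itself, it is deleted. Otherwise the wall does not separate
   1 from x, and pulling it back by x leaves the same question for the shorter word. *)
have [e|ne] := eqVneq (refl a b k) x.
  rewrite e mulgA xx mul1g; split; first by exists s.
  by exists x, 1%g; split; rewrite ?mul1g ?invg1 ?mulg1 //; apply: gen1.
have sx : (0 < wall x a b k) = (0 < wall 1%g a b k).
  apply/eqP; apply: contraNT ne => h; apply/eqP.
  by case: xS h => i [j [l [ij ->]]] h; apply: (simple_side ij ab h).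
move: sx; rewrite -[x in wall x a b k]mulg1 wallM => sx; rewrite -sx in d.
have ab' : finpart x a != finpart x b by rewrite (inj_eq perm_inj).
have [[s' [s'S ss' e]] [r [u [rS uS ru]]]] := IH _ _ _ sS ab' d.
have cj := refl_conj k (simple_reflsW xS) ab.
split.
  exists (x :: s'); split.
  - by move=> y; rewrite inE => /orP [/eqP ->|/s'S].
  - by rewrite /= ss'.
  by rewrite big_cons -e !mulgA cj.
exists r, (x * u)%g; split => //; first by apply: genM => //; apply: gen_in.
by rewrite invgM !mulgA -(mulgA x u) -(mulgA x) -ru cj xV -mulgA xx mulg1.
Qed.

(** While a simple wall separates x from the base alcove, reflecting in it lowers [sqdist]. The
    final t will be recognised as an element of [Omega]. *)
Lemma alcove_decomposition x : WGSp n x ->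
  exists s t, [/\ {in s, forall y, simple_refls y}, WGSp n t,
    forall i j k, simple_wall i j k -> (0 < wall t i j k) = (0 < wall 1%g i j k) &
    x = (\prod_(y <- s) y * t)%g].
Proof.
have [m] := ubnP `|sqdist x|%N; elim: m x => // m IH x lem xW.
have [h|] := pselect (forall i j k, simple_wall i j k ->
    (0 < wall x i j k) = (0 < wall 1%g i j k)).
  by exists [::], x; split=> //; rewrite big_nil mul1g.
move=> /existsNP [i] /existsNP [j] /existsNP [k] /not_implyP [sij /eqP d].
have [ij _] := simple_wallP sij.
have [c c0 e] := sqdist_refl k xW ij.
have wx := wall_neq0 x k ij; have w1 := wall_neq0 1%g k ij.
have neg : wall x i j k * wall 1%g i j k < 0 by move: d wx w1; nia.
have [] := IH (refl i j k * x)%g.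
- have := sqdist_ge0 x; have := sqdist_ge0 (refl i j k * x)%g.
  have : c * (wall x i j k * wall 1%g i j k) < 0 by nia.
  by rewrite e; lia.
- by apply: WGSpM => //; apply: refl_WGSp.
move=> s [t [sS tW ts ex]]; exists (refl i j k :: s), t; split => //.
  move=> y; rewrite inE => /orP [/eqP ->|/sS //]; by exists i, j, k.
by rewrite big_cons -mulgA -ex mulgA reflK // mul1g.
Qed.

End Walls.

(** * The base alcove and its stabilizer *)

Section Alcoves.
Variables (R : realType) (n : nat).
Local Notation N := (2 * n)%N.
Implicit Types (x y t : extW N) (a b c i j : 'I_N) (k : int) (v : 'rV[R]_N).

Lemma Vsp_closed : GRing.submod_closed [in @Vsp R n].
Proof.
split; first by rewrite inE => H [[+ _] _]; rewrite inE.
move=> r u v; rewrite !inE => uV vV H [HV HX].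
have /= := HV.2 r u v; rewrite !inE; apply; [exact: uV|exact: vV].
Qed.

Lemma Vsp_realv (z : 'rV[int]_N) : Xstar z -> Vsp (realv R z).
Proof. by move=> zX; apply: sub_gen_smallest; exists z. Qed.

Lemma VspD (r : R) u v : Vsp u -> Vsp v -> Vsp (r *: u + v).
Proof. by move=> uV vV; have := Vsp_closed.2 r u v; rewrite !inE; apply. Qed.

Lemma Vsp0 : Vsp (0 : 'rV[R]_N).
Proof. by have := Vsp_closed.1; rewrite inE. Qed.

Lemma Vsp_min (H : set 'rV[R]_N) : GRing.submod_closed [in H] ->
  (forall z, Xstar z -> H (realv R z)) -> forall v, Vsp v -> H v.
Proof. by move=> HV HX; apply: smallest_sub => // _ [z zX <-]; apply: HX. Qed.

Lemma Vsp_rev v i j : Vsp v -> v 0 i + v 0 (rev_ord i) = v 0 j + v 0 (rev_ord j).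
Proof.
apply: (Vsp_min (H := [set v | v 0 i + v 0 (rev_ord i) = v 0 j + v 0 (rev_ord j)])).
  split; first by rewrite inE /= !mxE.
  move=> r u w; rewrite !inE /= !mxE => e1 e2.
  by rewrite addrACA -mulrDr e1 e2 mulrDr addrACA.
by move=> z zX; rewrite /= !mxE -!rmorphD /= (zX i j).
Qed.

Lemma Vsp_perm (s : 'S_N) v : W0 s -> Vsp v -> Vsp (col_perm s v).
Proof.
move=> sW; apply: (Vsp_min (H := [set v | Vsp (col_perm s v)])).
  split; first by rewrite inE /= linear0; apply: Vsp0.
  by move=> r u w; rewrite !inE /= linearP; apply: VspD.
move=> z zX /=; have -> : col_perm s (realv R z) = realv R (col_perm s z).
  by apply/rowP => c; rewrite !mxE.
by apply: Vsp_realv => i j; rewrite !mxE !sW; apply: zX.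
Qed.

Lemma Vsp_aff_act x v : WGSp n x -> Vsp v -> Vsp (aff_act x v).
Proof.
move=> [xX xW] vV; rewrite /aff_act -[realv _ _]scale1r; apply: VspD.
  exact: Vsp_realv.
exact: Vsp_perm.
Qed.

Lemma aff_actE x v c : aff_act x v 0 c = (transl x 0 c)%:~R + v 0 (finpart x c).
Proof. by rewrite !mxE. Qed.

Lemma aff_actM x y v : aff_act (x * y)%g v = aff_act x (aff_act y v).
Proof. by apply/rowP => c; rewrite !aff_actE translM finpartM rmorphD addrA. Qed.

Lemma aff_act_refl a b k v : a != b -> Vsp v ->
  aff_act (refl a b k) v = v - (root_pairing a b v - k%:~R) *: realv R (coroot a b).
Proof.
move=> ab vV; apply/rowP => c; rewrite aff_actE translR /=.
rewrite (rperm_reflect (z := fun c => v 0 c) c ab); last by move=> i j; apply: Vsp_rev.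
by rewrite 3!mxE /realv [map_mx _ _ _ _]mxE /root_pairing rmorphM /=; ring.
Qed.

Lemma is_affreflP a b k x : a != b -> is_affrefl R a b k x <-> x = refl a b k.
Proof.
move=> ab; split=> [[xW xR]|->]; last first.
  by split=> [|v]; [apply: refl_WGSp|apply: aff_act_refl].
have {}xR v : Vsp v -> aff_act x v = aff_act (refl a b k) v.
  by move=> vV; rewrite xR // aff_act_refl.
have tr c : transl x 0 c = transl (refl a b k) 0 c.
  have := congr1 (fun w : 'rV_N => w 0 c) (xR 0 Vsp0).
  by rewrite !aff_actE !mxE !addr0 => /intr_inj; rewrite -translR.
apply: extW_ext => // c; apply: val_inj.
(* The vector 0 has determined the translation; a vector of V with pairwise distinct entries
   determines the permutation. *)
have sV : Vsp (realv R (\row_(c < N) (c : nat)%:Z)).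
  apply: Vsp_realv => i j; rewrite !mxE /=; have := ltn_ord i; have := ltn_ord j.
  by lia.
have := congr1 (fun w : 'rV_N => w 0 c) (xR _ sV).
by rewrite !aff_actE tr => /addrI; rewrite !mxE => /intr_inj [].
Qed.

Lemma SaffE : @Saff R n = @simple_refls n.
Proof.
apply/seteqP; split=> x.
  move=> [[i [j [s xr]]]|[i [j [s xr]]]].
    have sw : simple_wall i j 0 by left.
    by exists i, j, 0; split=> //; apply/(is_affreflP _ _ (simple_wallP sw).1).
  have sw : simple_wall i j 1 by right.
  by exists i, j, 1; split=> //; apply/(is_affreflP _ _ (simple_wallP sw).1).
move=> [i [j [k [sw ->]]]]; have ij := (simple_wallP sw).1.
by case: (sw) => -[s ->]; [left|right]; exists i, j; split=> //; apply/is_affreflP.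
Qed.

Lemma gen_simple_Waff x : gen (@simple_refls n) x -> WaffGSp R x.
Proof.
apply: gen_min; first exact: gen_closed.
move=> y [i [j [k [sw ->]]]]; have ij := (simple_wallP sw).1.
by apply: gen_in; exists i, j, k; split=> //; apply/is_affreflP.
Qed.

Lemma alcove_lt v a b : base_alcove v -> (a < b)%N -> v 0 b < v 0 a < v 0 b + 1.
Proof.
move=> [vV vs vh] ab.
have succ i j : j = i.+1 :> nat -> v 0 j < v 0 i.
  move=> ij; have [iltn|ngei] := ltnP i n.
    by rewrite -subr_gt0; apply: vs.
  (* Past the middle, v_i - v_j equals the difference at the mirror pair, which is a simple root. *)
  have sr : simple_root (rev_ord j) (rev_ord i).
    by split=> /=; have := ltn_ord j; lia.
  by have := vs _ _ sr; have := Vsp_rev i j vV; rewrite /root_pairing; lra.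
have lt d i j : (j = i + d.+1 :> nat)%N -> v 0 j < v 0 i.
  elim: d j => [|d IH] j e; first by apply: succ; lia.
  have hl : (i + d.+1 < N)%N by have := ltn_ord j; lia.
  by apply: lt_trans (IH (Ordinal hl) _); rewrite //=; apply: succ; rewrite /= e; lia.
have le i j : (i <= j)%N -> v 0 j <= v 0 i.
  rewrite leq_eqVlt => /orP [/eqP /val_inj -> //|ij].
  by apply/ltW/(@lt (j - i.+1)%N); lia.
apply/andP; split; first by apply: (@lt (b - a.+1)%N); lia.
have N0 : (0 < N)%N by apply: leq_ltn_trans (ltn_ord a).
have Nl : (N.-1 < N)%N by lia.
have := vh (Ordinal N0) (Ordinal Nl); rewrite /root_pairing => /(_ (conj erefl erefl)).
have := le (Ordinal N0) a (leq0n _); have := le b (Ordinal Nl) _.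
rewrite /= -ltnS prednK // ltn_ord => /(_ isT); lra.
Qed.

(** No reflecting hyperplane meets the base alcove: there, differences of two coordinates lie
    strictly between consecutive integers. *)
Lemma alcove_side v a b k : base_alcove v -> a != b ->
  (0 < v 0 a - v 0 b - k%:~R) = (0 < wall 1%g a b k).
Proof.
move=> vA ab; rewrite wall1.
have aN := ltn_ord a; have bN := ltn_ord b.
have [lt_ab|lt_ba|/val_inj e] := ltngtP a b; last by rewrite e eqxx in ab.
  have := alcove_lt vA lt_ab => h.
  have [k0|k0] := lerP k 0.
    have : (k%:~R : R) <= 0 by rewrite lerz0.
    by move=> ?; rewrite (_ : (0 < _ - k * _)); [lra|nia].
  have : (1 : R) <= k%:~R by rewrite ler1z.
  by move=> ?; rewrite [RHS](_ : _ = false); [lra|apply/negbTE; rewrite -leNgt; nia].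
have := alcove_lt vA lt_ba => h.
have [k0|k0] := lerP 0 k.
  have : (0 : R) <= k%:~R by rewrite ler0z.
  by move=> ?; rewrite [RHS](_ : _ = false); [lra|apply/negbTE; rewrite -leNgt; nia].
have : (k%:~R : R) <= -1 by rewrite -[-1]/((-1)%:~R) ler_int; lia.
by move=> ?; rewrite (_ : (0 < _ - k * _)); [lra|nia].
Qed.

Definition alcove_center : 'rV[R]_N := N%:R^-1 *: realv R (\row_c - (c : nat)%:Z).

Lemma aff_act_center x c : (0 < n)%N ->
  aff_act x alcove_center 0 c = N%:R^-1 * (pos x c)%:~R.
Proof.
move=> n0; have N0 : (N%:R : R) != 0 by rewrite pnatr_eq0; lia.
rewrite aff_actE !mxE /pos rmorphB rmorphM /= rmorphN mulrBr.
by rewrite -[(N%:Z)%:~R]/(N%:R) mulKf // mulrN.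
Qed.

Lemma center_alcove x : (0 < n)%N -> WGSp n x ->
  (forall i j k, simple_wall i j k -> (0 < wall x i j k) = (0 < wall 1%g i j k)) ->
  base_alcove (aff_act x alcove_center).
Proof.
move=> n0 xW xs; have N0 : (0 : R) < N%:R by rewrite ltr0n; lia.
have NV : (0 : R) < N%:R^-1 by rewrite invr_gt0.
split.
- apply: Vsp_aff_act => //; rewrite /alcove_center -[_ *: _]addr0.
  apply: VspD Vsp0; apply: Vsp_realv => i j; rewrite !mxE /=.
  by have := ltn_ord i; have := ltn_ord j; lia.
- move=> i j s; have sw : simple_wall i j 0 by left.
  rewrite /root_pairing !aff_act_center // -mulrBr -rmorphB pmulr_rgt0 // ltr0z.
  have -> : pos x i - pos x j = wall x i j 0 by rewrite /wall mul0r subr0.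
  by rewrite xs // wall1; case: s => i1 j1; lia.
move=> i j s; have sw : simple_wall i j 1 by right.
rewrite /root_pairing !aff_act_center // -mulrBr -rmorphB mulrC ltr_pdivrMr //.
rewrite mul1r -[N%:R]/(N%:Z%:~R) ltr_int.
have := xs _ _ _ sw; have := wall_neq0 x 1 (simple_wallP sw).1.
by rewrite wall1 /wall; case: s => -> ->; have := ltn_ord i; lia.
Qed.

Lemma center_base_alcove : (0 < n)%N -> base_alcove alcove_center.
Proof.
move=> n0; have -> : alcove_center = aff_act 1%g alcove_center.
  by apply/rowP => c; rewrite aff_actE /= !mxE perm1 add0r.
by apply: center_alcove => //; apply: WGSp1.
Qed.

Lemma alcove_side_center x a b k : (0 < n)%N ->
  base_alcove (aff_act x alcove_center) -> a != b ->
  (0 < wall x a b k) = (0 < wall 1%g a b k).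
Proof.
move=> n0 xA ab; have N0 : (0 : R) < N%:R by rewrite ltr0n; lia.
rewrite -(alcove_side k xA ab) !aff_act_center // -mulrBr -rmorphB.
rewrite [RHS]subr_gt0 [in RHS]mulrC ltr_pdivlMr // -[N%:R]/(N%:Z%:~R) -rmorphM ltr_int.
by rewrite /wall subr_gt0.
Qed.

Lemma Omega_side t a b k : (0 < n)%N -> Omega R t -> a != b ->
  (0 < wall t a b k) = (0 < wall 1%g a b k).
Proof.
move=> n0 [tW tA]; apply: alcove_side_center => //.
by rewrite -tA; exists alcove_center => //; apply: center_base_alcove.
Qed.

Lemma Omega_sideM x t a b k : (0 < n)%N -> Omega R t -> a != b ->
  (0 < wall (x * t)%g a b k) = (0 < wall x a b k).
Proof.
move=> n0 tO ab; rewrite -[x in RHS]mulg1 !wallM (Omega_side _ n0 tO) //.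
by rewrite (inj_eq perm_inj).
Qed.

Lemma alcove_sub t : (0 < n)%N -> WGSp n t ->
  (forall a b k, a != b -> (0 < wall t a b k) = (0 < wall 1%g a b k)) ->
  aff_act t @` @base_alcove R n `<=` @base_alcove R n.
Proof.
move=> n0 tW ts _ [v vA <-].
have tst a b k : a != b ->
    (0 < aff_act t v 0 a - aff_act t v 0 b - k%:~R) = (0 < wall 1%g a b k).
  move=> ab; rewrite -ts // -[t in wall t]mulg1 wallM -(alcove_side _ vA).
    by rewrite !aff_actE rmorphD rmorphB /=; congr (0 < _); ring.
  by rewrite (inj_eq perm_inj).
split.
- by apply: Vsp_aff_act => //; case: vA.
- move=> i j s; have sw : simple_wall i j 0 by left.
  have [ij _] := simple_wallP sw; have := tst _ _ 0 ij.
  by rewrite subr0 /root_pairing => ->; case: s => i1 j1; rewrite wall1; lia.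
move=> i j s; have sw : simple_wall i j 1 by right.
have [ij _] := simple_wallP sw; have ji : j != i by rewrite eq_sym.
have := tst j i (-1) ji; rewrite /root_pairing wall1.
case: s => -> ->; have iN := ltn_ord i.
rewrite [X in _ = X -> _](_ : _ = true); last by lia.
by rewrite rmorphN rmorph1; lra.
Qed.

(** One inclusion is [alcove_sub] for t, the other is [alcove_sub] for its inverse, whose walls are
    those of t transported by [wallM]. *)
Lemma OmegaP t : (0 < n)%N -> WGSp n t ->
  (forall i j k, simple_wall i j k -> (0 < wall t i j k) = (0 < wall 1%g i j k)) ->
  Omega R t.
Proof.
move=> n0 tW tsim.
have ts a b k : a != b -> (0 < wall t a b k) = (0 < wall 1%g a b k).
  by apply: alcove_side_center => //; apply: center_alcove.
split => //; apply/seteqP; split; first exact: alcove_sub.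
have tVs a b k : a != b -> (0 < wall t^-1%g a b k) = (0 < wall 1%g a b k).
  move=> ab; set s := finpart t; set l := transl t.
  have sab : (s^-1)%g a != (s^-1)%g b by rewrite (inj_eq perm_inj).
  pose k0 := k + l 0 ((s^-1)%g a) - l 0 ((s^-1)%g b).
  have ek : k0 - l 0 ((s^-1)%g a) + l 0 ((s^-1)%g b) = k by rewrite /k0; ring.
  have := ts _ _ k0 sab.
  rewrite -(mulgV t) [in RHS]wallM -[t in LHS]mulg1 [in LHS]wallM.
  by rewrite -/s -/l !permKV ek mulgV => ->.
move=> v vA; exists (aff_act t^-1%g v).
  apply: (alcove_sub n0 (WGSpV tW) tVs); by exists v.
by rewrite -aff_actM mulgV; apply/rowP => c; rewrite aff_actE /= mxE perm1 add0r.
Qed.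

End Alcoves.

(** * Admissible elements are permissible *)

Section ConvexHull.
Variables (R : realType) (n : nat).
Local Notation N := (2 * n)%N.
Implicit Types (x y t : extW N) (a b c : 'I_N) (k : int) (z v : 'rV[R]_N).

Lemma conv_hull_conv (A : set 'rV[R]_N) u v (r : R) : 0 <= r -> r <= 1 ->
  conv_hull A u -> conv_hull A v -> conv_hull A (r *: u + (1 - r) *: v).
Proof.
move=> r0 r1 uA vA H [HC HA].
have := HC u v (Itv01 r0 r1); rewrite !inE; apply; [exact: uA|exact: vA].
Qed.

Lemma conv_hull_min (A H : set 'rV[R]_N) :
  (forall u v (r : R), 0 <= r -> r <= 1 -> H u -> H v -> H (r *: u + (1 - r) *: v)) ->
  A `<=` H -> conv_hull A `<=` H.
Proof.
move=> HC; apply: smallest_sub => u v r; rewrite !inE => uH vH.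
by apply: HC.
Qed.

Definition perm_hull (mu : 'rV[int]_N) : set 'rV[R]_N :=
  conv_hull [set realv R (col_perm s mu) | s in [set: 'S_N]].

Lemma perm_hull_perm mu (s : 'S_N) z :
  perm_hull mu z -> perm_hull mu (col_perm s z).
Proof.
apply: (conv_hull_min (H := [set z | perm_hull mu (col_perm s z)])) => [u v r r0 r1|].
  by rewrite /= linearD !linearZ /=; apply: conv_hull_conv.
move=> _ [p _ <-] /=; apply: sub_gen_smallest; exists (s * p)%g => //.
by apply/rowP => c; rewrite !mxE permM.
Qed.

(** The affine reflection of GL_2n in z_a - z_b = k; a reflection of GSp_2n is one of these or a
    product of two with disjoint supports. *)
Definition glrefl a b k : extW N :=
  ExtW (k *: (delta_mx 0 a - delta_mx 0 b)) (tperm a b).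

Lemma refl_glrefl a b k : b = rev_ord a -> refl a b k = glrefl a b k.
Proof. by move=> ->; rewrite /refl /glrefl /coroot /rperm eqxx. Qed.

Lemma refl_glrefl2 a b k : b != rev_ord a ->
  refl a b k = (glrefl a b k * glrefl (rev_ord b) (rev_ord a) k)%g.
Proof.
move=> e; apply: extW_ext => c; last first.
  by rewrite /= /rperm (negbTE e) (tpermC (rev_ord b)).
have ra : (a == rev_ord a) = false by apply/negbTE; rewrite eq_sym rev_neq.
have rb : (b == rev_ord b) = false by apply/negbTE; rewrite eq_sym rev_neq.
have ab : (a == rev_ord b) = false by rewrite -rev_eqC eq_sym; apply: negbTE.
rewrite translM translR corootE (negbTE e) /= !mxE -!natz.
have -> : (tperm a b c == rev_ord b) = (c == rev_ord b).
  by case: tpermP => [->|->|_ _ //]; rewrite ?ab ?rb.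
have -> : (tperm a b c == rev_ord a) = (c == rev_ord a).
  by case: tpermP => [->|->|_ _ //]; rewrite ?ra ?(negbTE e).
by rewrite !natz; ring.
Qed.

(** Vertices lie in the closure of the alcove, so a strict inequality at its interior point becomes
    a weak one. *)
Lemma omega_side x a b k (i : 'I_N) : a != b ->
  if 0 < wall x a b k then
    0 <= transl x 0 a - transl x 0 b - k
         + (finpart x a < i)%N%:Z - (finpart x b < i)%N%:Z
  else transl x 0 a - transl x 0 b - k
         + (finpart x a < i)%N%:Z - (finpart x b < i)%N%:Z <= 0.
Proof.
move=> ab; have := wall_neq0 x k ab; rewrite /wall /pos.
have := ltn_ord (finpart x a); have := ltn_ord (finpart x b).
move: (nat_of_ord (finpart x a)) (nat_of_ord (finpart x b)) => u v.
move: (transl x 0 a) (transl x 0 b) => l m hv hu h.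
by case: ifP => h'; case: (ltnP u i) => hui; case: (ltnP v i) => hvi; nia.
Qed.

Lemma vertex_wall x a b k (i : 'I_N) :
  aff_act x (omega R i) 0 a - aff_act x (omega R i) 0 b - k%:~R =
  (transl x 0 a - transl x 0 b - k + (finpart x a < i)%N%:Z - (finpart x b < i)%N%:Z)%:~R.
Proof. by rewrite !aff_actE !mxE !(rmorphD, rmorphB, rmorphN) /= !pmulrn; ring. Qed.

(** X - w lies on the segment between the reflected difference Z and the image of Z under the
    transposition; the hull is convex and stable under permutations. *)
Lemma hull_glrefl mu x a b k (i : 'I_N) : a != b ->
  (0 < wall x a b k) = (0 < wall 1%g a b k) ->
  perm_hull mu (aff_act (glrefl a b k * x)%g (omega R i) - omega R i) ->
  perm_hull mu (aff_act x (omega R i) - omega R i).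
Proof.
move=> ab sxy; rewrite aff_actM; set w := omega R i; set X := aff_act x w.
pose cc := X 0 a - X 0 b - k%:~R; pose d := w 0 a - w 0 b - k%:~R.
have Xg c : aff_act (glrefl a b k) X 0 c =
    k%:~R * ((c == a)%:R - (c == b)%:R) + X 0 (tperm a b c).
  by rewrite aff_actE /= !mxE !eqxx rmorphM rmorphB /= !natz -!pmulrn.
have ba : (b == a) = false by rewrite eq_sym; apply: negbTE.
have w1 : aff_act 1%g w = w.
  by apply/rowP => c; rewrite aff_actE /= !mxE perm1 add0r.
have sgn : (0 <= cc /\ 0 <= d) \/ (cc <= 0 /\ d <= 0).
  have := omega_side x k i ab; have := omega_side 1%g k i ab.
  rewrite -sxy /cc /d vertex_wall -w1 vertex_wall !ler0z !lerz0.
  by case: ifP => _ h1 h2; [left|right].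
have [cd0|cd0] := eqVneq (cc + d) 0.
  have cc0 : cc = 0 by case: sgn => -[]; lra.
  rewrite (_ : _ - w = X - w) //; congr (_ - _); apply/rowP => c; rewrite Xg.
  case: tpermP => [->|->|/eqP/negbTE -> /eqP/negbTE ->].
  - by rewrite eqxx (negbTE ab) /=; move: cc0; rewrite /cc; lra.
  - by rewrite eqxx ba /=; move: cc0; rewrite /cc; lra.
  by rewrite subrr mulr0 add0r.
(* The form z_a - z_b takes the values -(cc + d) at Z, cc + d at its mirror image and cc - d at X -
   w; this determines r. *)
move=> zC; pose r := d / (cc + d).
have r01 : 0 <= r /\ r <= 1.
  case: sgn => -[c0 d0].
    have cdp : 0 < cc + d by rewrite lt0r cd0; lra.
    by rewrite /r ler_pdivlMr // ler_pdivrMr // mul0r mul1r; lra.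
  have cdp : cc + d < 0 by rewrite lt_neqAle cd0; lra.
  by rewrite /r ler_ndivlMr // ler_ndivrMr // mul0r mul1r; lra.
have := conv_hull_conv r01.1 r01.2 zC (perm_hull_perm (tperm a b) zC).
set Z := _ - w in zC *; suff -> : X - w = r *: Z + (1 - r) *: col_perm (tperm a b) Z by [].
have combE (u : 'rV[R]_N) c : (r *: u + (1 - r) *: col_perm (tperm a b) u) 0 c =
    r * u 0 c + (1 - r) * u 0 (tperm a b c) by rewrite !mxE.
have subE (u v : 'rV[R]_N) c : (u - v) 0 c = u 0 c - v 0 c by rewrite !mxE.
apply/rowP => c; rewrite combE /Z !subE !Xg tpermK.
case: tpermP => [->|->|/eqP/negbTE ca /eqP/negbTE cb].
- by rewrite !eqxx ba (negbTE ab) /r /=; move: cd0; rewrite /cc /d => cd0; field.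
- by rewrite !eqxx ba (negbTE ab) /r /=; move: cd0; rewrite /cc /d => cd0; field.
by rewrite ca cb; ring.
Qed.

Lemma WaffGL_translation mu x :
  WaffGL (x * (translation mu)^-1)%g <-> \sum_c transl x 0 c = \sum_c mu 0 c.
Proof.
rewrite /WaffGL /=.
have -> : \sum_c (transl x + col_perm (finpart x) (- col_perm 1^-1%g mu)) 0 c =
    \sum_c transl x 0 c - \sum_c mu 0 c.
  rewrite [X in _ - X](reindex_inj (@perm_inj _ (finpart x))) -sumrB.
  by apply: eq_bigr => c _; rewrite !mxE invg1 perm1.
by split=> [/eqP|->]; rewrite ?subrr // subr_eq0 => /eqP.
Qed.

Lemma sum_transl_refl x a b k : a != b ->
  \sum_c transl (refl a b k * x)%g 0 c = \sum_c transl x 0 c.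
Proof.
move=> ab; under eq_bigr do rewrite translM translR.
have e : \sum_c transl x 0 (rperm a b c) = \sum_c transl x 0 c.
  by rewrite [RHS](reindex_inj (@perm_inj _ (rperm a b))).
rewrite big_split /= e.
have cor : \sum_c coroot a b 0 c = 0.
  transitivity (\sum_c coroot a b 0 c * 1); first by apply: eq_bigr => c _; rewrite mulr1.
  by rewrite (@sum_coroot n (fun=> 1)) // subrr mulr0.
by rewrite -mulr_sumr cor mulr0 add0r.
Qed.

Lemma PermGL_refl mu x a b k : WGSp n x -> a != b ->
  (0 < wall x a b k) = (0 < wall 1%g a b k) ->
  PermGL R mu (refl a b k * x)%g -> PermGL R mu x.
Proof.
move=> xW ab sx [/WaffGL_translation s h]; split.
  by apply/WaffGL_translation; rewrite -s sum_transl_refl.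
move=> i; have [e|e] := eqVneq b (rev_ord a).
  by apply: (hull_glrefl ab sx); rewrite -refl_glrefl //; apply: h.
have h' := h i; rewrite refl_glrefl2 // -mulgA in h'.
have rab : rev_ord b != rev_ord a by rewrite rev_eq eq_sym.
have sym y : WGSp n y -> wall y (rev_ord b) (rev_ord a) k = wall y a b k.
  by move=> yW; have := pos_rev a b yW; rewrite /wall; lia.
(* The two factors are handled one at a time; the mirror factor fixes the coordinates a and b, so
   the side condition for (a, b) passes to the intermediate element. *)
apply: (hull_glrefl (k := k) rab); first by rewrite !sym //; apply: WGSp1.
apply: (hull_glrefl (k := k) ab _ h').
have gp c : c != rev_ord a -> c != rev_ord b ->
    pos (glrefl (rev_ord b) (rev_ord a) k * x)%g c = pos x c.
  move=> ca cb; have tc : tperm (rev_ord b) (rev_ord a) c = c.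
    by rewrite tpermD // eq_sym.
  rewrite posM /= !mxE tc (negbTE ca) (negbTE cb).
  by rewrite andbF subrr mulr0 mulr0 add0r.
have arb : a != rev_ord b by rewrite -rev_eqC eq_sym.
by rewrite -sx /wall !gp // eq_sym rev_neq.
Qed.

Lemma PermGL_translation mu (s : 'S_N) :
  PermGL R mu (translation (col_perm s mu)).
Proof.
split.
  apply/WaffGL_translation => /=.
  rewrite [RHS](reindex_inj (@perm_inj _ s)); apply: eq_bigr => c _; by rewrite mxE.
move=> i; rewrite /aff_act /= col_perm1 addrK.
by apply: sub_gen_smallest; exists s.
Qed.

Lemma bruhat_side u (v : extW N) t : (0 < n)%N -> Omega R t ->
  bruhat_step (@Saff R n) u v ->
  exists a b k, [/\ a != b, v = (refl a b k * u)%g, WGSp n u &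
    (0 < wall (u * t)%g a b k) = (0 < wall 1%g a b k)].
Proof.
move=> n0 tO; rewrite SaffE.
move=> [r [k [l [[r0 [w [r0S wS ->]]] -> [[su [suk suS ue]] _] [_ lmin] kl]]]].
have wW := gen_simple_WGSp wS.
have uS : gen (@simple_refls n) u by rewrite ue; apply: gen_prod.
have uW := gen_simple_WGSp uS.
case: r0S => i [j [k0 [/simple_wallP [ij _] e0]]].
set y := (u * w)%g; have yW : WGSp n y by apply: WGSpM.
pose a := (finpart y)^-1%g i; pose b := (finpart y)^-1%g j.
pose h := k0 + transl y 0 a - transl y 0 b.
have ab : a != b by rewrite (inj_eq perm_inj).
have eh : h - transl y 0 a + transl y 0 b = k0 by rewrite /h; ring.
have := refl_conj h yW ab; rewrite !permKV eh -e0 => cj.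
have ve : (u * (w * r0 * w^-1) = refl a b h * u)%g.
  by apply: (mulIg w); rewrite -(mulgA _ u) -/y -cj !mulgA mulgKV.
(* If the wall separated 1 from u, deleting a letter would write v with fewer letters than u,
   against the comparison of lengths. *)
have su1 : (0 < wall u a b h) = (0 < wall 1%g a b h).
  apply/eqP; apply/negPn/negP; rewrite {1}ue => d.
  have [[s' [s'S ss' es']] _] := strong_exchange suS ab d.
  have : (l <= size s')%N by apply: lmin; exists s'; rewrite ve ue.
  by move: kl; rewrite -suk ss'; lia.
by exists a, b, h; split => //; rewrite -su1 (Omega_sideM _ _ n0 tO ab).
Qed.

Lemma AdmGSp_PermGL mu x : (0 < n)%N -> AdmGSp R mu x -> PermGL R mu x.
Proof.
move=> n0 [xW [s _ [w [w' [t [_ tO -> ew' ww']]]]]].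
have : PermGL R mu (w' * t)%g by rewrite -ew'; apply: PermGL_translation.
elim: ww' => {x xW ew'} [u v uv|//|u v z _ uv _ vz /vz //].
have [a [b [k [ab -> uW sd]]]] := bruhat_side n0 tO uv.
rewrite -mulgA; apply: PermGL_refl => //.
by apply: WGSpM => //; case: tO.
Qed.

End ConvexHull.

(** * Vertex vectors *)

Section ConcaveSums.
Variable m : nat -> int.
Hypothesis m_anti : forall i j, (i <= j)%N -> m j <= m i.

Definition topsum (r : nat) : int := \sum_(i < r) m i.

Lemma topsumS r : topsum r.+1 = topsum r + m r.
Proof. by rewrite /topsum big_ord_recr. Qed.

Lemma topsum_shift p q d : (p <= q)%N ->
  topsum (q + d) - topsum q <= topsum (p + d) - topsum p.
Proof.
move=> pq; elim: d => [|d IH]; first by rewrite !addn0 !subrr.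
rewrite !addnS !topsumS; have : m (q + d) <= m (p + d) by apply: m_anti; lia.
by lia.
Qed.

Lemma topsum_slope p d : topsum (p + d) - topsum p <= d%:Z * m p.
Proof.
elim: d => [|d IH]; first by rewrite addn0 subrr mul0r.
rewrite addnS topsumS; have : m (p + d) <= m p by apply: m_anti; lia.
by nia.
Qed.

Variable I : finType.
Implicit Types (J K : {set I}) (f : I -> int).

Lemma sum_setUI f J K :
  \sum_(c in J) f c + \sum_(c in K) f c =
  \sum_(c in J :|: K) f c + \sum_(c in J :&: K) f c.
Proof.
rewrite (big_setID J (A := J :|: K)) (big_setID J (A := K)) /=.
by rewrite finset.setIUl finset.setIid finset.setDUl finset.setDv finset.set0U (finset.setUidPl _) ?subsetIr // (finset.setIC K); ring.
Qed.

Lemma sum_mem a J : \sum_(c in J) (c == a)%:Z = (a \in J)%:Z.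
Proof.
rewrite big_mkcond (bigD1 a) //= eqxx big1 ?addr0; first by case: ifP.
by move=> c /negbTE ->; case: ifP.
Qed.

(** By concavity, adding #|K :\: J| elements gains no more from #|J| than from #|J :&: K|. *)
Lemma topsum_submod J K :
  topsum #|J :|: K| + topsum #|J :&: K| <= topsum #|J| + topsum #|K|.
Proof.
have := @topsum_shift #|J :&: K| #|J| #|K :\: J| (subset_leq_card (subsetIl _ _)).
have -> : (#|J :&: K| + #|K :\: J| = #|K|)%N by rewrite finset.setIC cardsID.
have -> : (#|J| + #|K :\: J| = #|J :|: K|)%N.
  by rewrite -(cardsID J (J :|: K)) finset.setIUl finset.setIid finset.setDUl finset.setDv finset.set0U (finset.setUidPl _) ?subsetIr.
by lia.
Qed.

End ConcaveSums.

(** * Periodicity and duality of the vertex vectors *)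

Section VertexVectors.
Variable n : nat.
Local Notation N := (2 * n)%N.
Hypothesis n0 : (0 < n)%N.
Implicit Types (x y : extW N) (a b c i j : 'I_N) (k t : int) (J K : {set 'I_N}).

Let N0 : (0 < N)%N. Proof. by lia. Qed.

(* The vertices of the base alcove extend to a sequence indexed by the
   integers with omega_(t+N) = omega_t + (1,...,1), and [vertex x t] is
   x(omega_t) - omega_t. *)
Definition vertex x t c : int := ceilz N (t + pos x c) - ceilz N (t - (c : nat)%:Z).

Lemma vertex_transl x t c :
  vertex x t c = transl x 0 c + ceilz N (t - (finpart x c : nat)%:Z)
                 - ceilz N (t - (c : nat)%:Z).
Proof.
rewrite /vertex /pos (_ : t + _ = t - (finpart x c : nat)%:Z + transl x 0 c * N%:Z); last by ring.
by rewrite ceilz_shift // (addrC (ceilz _ _)).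
Qed.

Lemma vertex_ord x (i c : 'I_N) : vertex x (i : nat)%:Z c =
  transl x 0 c + (finpart x c < i)%N%:Z - (c < i)%N%:Z.
Proof.
rewrite vertex_transl; have iN := ltn_ord i.
have e (j : 'I_N) : ceilz N (i%:Z - j%:Z) = (j < i)%N%:Z.
  have jN := ltn_ord j; case: (ltnP j i) => ij; first by rewrite ceilz_gt0 //; lia.
  by rewrite ceilz_le0 //; lia.
by rewrite !e.
Qed.

Lemma vertex_periodic x t k c : vertex x (t + k * N%:Z) c = vertex x t c.
Proof.
rewrite /vertex [t + _ + pos _ _]addrAC [t + _ - _]addrAC !ceilz_shift //; ring.
Qed.

Lemma sum_vertex x t : \sum_c vertex x t c = \sum_c transl x 0 c.
Proof.
under eq_bigr do rewrite vertex_transl.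
rewrite sumrB big_split /=.
rewrite [X in _ - X](reindex_inj (@perm_inj _ (finpart x))) /=.
by rewrite addrK.
Qed.

(** Reversing the coordinates turns omega_t into minus omega_(-t), and the permutation part of x
    commutes with the reversal. *)
Lemma vertex_rev x t c : WGSp n x ->
  vertex x t (rev_ord c) = transl x 0 c + transl x 0 (rev_ord c) - vertex x (- t) c.
Proof.
move=> [xX xW]; rewrite !vertex_transl xW.
have e (j : 'I_N) : ceilz N (t - (rev_ord j : nat)%:Z) = - ceilz N (- t - (j : nat)%:Z).
  have -> : t - (rev_ord j : nat)%:Z = - (- t - (j : nat)%:Z + N%:Z - 1).
    by rewrite /=; have := ltn_ord j; lia.
  rewrite ceilzN // addrNK -[N%:Z]mul1r ceilz_shift //; ring.
by rewrite !e; ring.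
Qed.

End VertexVectors.

(** * Tight sets *)

Section TightSets.
Variables (n : nat) (m : nat -> int) (c0 : int).
Local Notation N := (2 * n)%N.
Hypothesis n0 : (0 < n)%N.
Hypothesis m_anti : forall i j, (i <= j)%N -> m j <= m i.
Hypothesis m_dual : forall i : 'I_N, m i + m (rev_ord i) = c0.
Implicit Types (x y : extW N) (a b c i j : 'I_N) (k t : int) (J K D : {set 'I_N}).

Let N0 : (0 < N)%N. Proof. by lia. Qed.

Local Notation h := (topsum m).

Lemma topsum_total : h N = n%:Z * c0.
Proof.
have e : h N = \sum_(i < N) m (rev_ord i).
  exact: (reindex_inj rev_ord_inj).
have : h N + h N = N%:Z * c0.
  rewrite {2}e -big_split /=.
  under eq_bigr => i _ do rewrite (m_dual i).
  by rewrite sumr_const card_ord -mulr_natl natz.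
by lia.
Qed.

(** By [m_dual] the r smallest of the N values are c0 minus the r largest. *)
Lemma topsum_dual r : (r <= N)%N -> h (N - r)%N = h N - r%:Z * c0 + h r.
Proof.
elim: r => [|r IH] rN; first by rewrite subn0 /topsum big_ord0; ring.
have rN' : (N - r.+1 < N)%N by lia.
have := m_dual (Ordinal rN'); rewrite /= (_ : (N - (N - r.+1).+1 = r)%N); last by lia.
have := IH (ltnW rN); rewrite (_ : (N - r = (N - r.+1).+1)%N); last by lia.
by rewrite !topsumS; lia.
Qed.

Definition vsum x t J : int := \sum_(c in J) vertex x t c.

Definition cap J : int := h #|J|.

Lemma vsumUI x t J K :
  vsum x t J + vsum x t K = vsum x t (J :|: K) + vsum x t (J :&: K).
Proof. exact: sum_setUI. Qed.

Lemma capUI J K : cap (J :|: K) + cap (J :&: K) <= cap J + cap K.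
Proof. exact: topsum_submod. Qed.

Lemma vsumD1 x t c J : c \in J -> vsum x t J = vertex x t c + vsum x t (J :\ c).
Proof. by move=> cJ; rewrite /vsum (big_setD1 c). Qed.

Lemma capD1 c J : c \in J -> cap J = cap (J :\ c) + m #|J|.-1.
Proof. by move=> cJ; rewrite /cap (cardsD1 c J) cJ add1n topsumS. Qed.

(* By Rado's theorem this says that all x(omega_t) - omega_t lie in the convex
   hull of the orbit of (m 0, ..., m (N-1)). *)
Definition permissible x : Prop :=
  \sum_c transl x 0 c = h N /\
  forall t J, vsum x t J <= cap J.

Definition tight x t J : bool := vsum x t J == cap J.

Section Fixed.
Variable x : extW N.
Hypotheses (xW : WGSp n x) (xP : permissible x).

Lemma similitude c : transl x 0 c + transl x 0 (rev_ord c) = c0.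
Proof.
have [xX _] := xW; have [s _] := xP.
have e : \sum_c transl x 0 c = \sum_c transl x 0 (rev_ord c).
  exact: (reindex_inj rev_ord_inj).
have : \sum_c transl x 0 c + \sum_c transl x 0 c = N%:Z * (transl x 0 c + transl x 0 (rev_ord c)).
  rewrite {2}e -big_split /=.
  under eq_bigr => i _ do rewrite (xX i c).
  by rewrite sumr_const card_ord -mulr_natl natz.
by rewrite s topsum_total; nia.
Qed.

Lemma vertex_dual t c : vertex x t (rev_ord c) = c0 - vertex x (- t) c.
Proof. by rewrite vertex_rev // similitude. Qed.

(** [vsum] is modular, while its bound [cap] is submodular; equality for J and K leaves no slack for
    the union and the intersection. *)
Lemma tightUI t J K : tight x t J -> tight x t K ->
  tight x t (J :|: K) /\ tight x t (J :&: K).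
Proof using m_anti xP.
clear n0 N0.
move=> /eqP tJ /eqP tK; have [_ le] := xP.
have := le t (J :|: K); have := le t (J :&: K).
have := vsumUI x t J K; have := capUI J K.
by move=> *; split; apply/eqP; lia.
Qed.

Lemma tightU t J K : tight x t J -> tight x t K -> tight x t (J :|: K).
Proof. by move=> tJ tK; case: (tightUI tJ tK). Qed.

Lemma tightI t J K : tight x t J -> tight x t K -> tight x t (J :&: K).
Proof. by move=> tJ tK; case: (tightUI tJ tK). Qed.

(** Removing c lowers [cap] by its last increment and must lower [vsum] by at least as much. *)
Lemma tight_ge t J c : tight x t J -> c \in J -> m #|J|.-1 <= vertex x t c.
Proof using xP.
clear n0 N0.
move=> /eqP tJ cJ; have [_ /(_ t (J :\ c))] := xP.
by move: tJ; rewrite (vsumD1 _ _ cJ) (capD1 cJ); lia.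
Qed.

Definition dualset J : {set 'I_N} := ~: [set rev_ord c | c in J]%SET.

Lemma in_dualset J c : (c \in dualset J) = (rev_ord c \notin J).
Proof.
rewrite !inE; congr (~~ _); apply/imsetP/idP => [[d dJ ->]|cJ].
  by rewrite rev_ordK.
by exists (rev_ord c); rewrite ?rev_ordK.
Qed.

(** Mirroring replaces entries by c0 minus the entries at - t; passing to the complement restores
    the sign, as the total is fixed. *)
Lemma tight_dual t J : tight x t J -> tight x (- t) (dualset J).
Proof.
move=> /eqP tJ; apply/eqP; set J' := [set rev_ord c | c in J]%SET.
have cJ : #|J'| = #|J| by apply: card_imset; apply: rev_ord_inj.
have le := max_card (mem J); rewrite card_ord in le.
have cd : #|dualset J| = (N - #|J|)%N.
  by apply: (canRL (addKn _)); rewrite -[RHS]card_ord -(cardsC J') cJ.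
rewrite /cap cd topsum_dual // -[h #|J|]tJ.
have sJ : vsum x t J = #|J|%:Z * c0 - \sum_(c in J') vertex x (- t) c.
  rewrite /vsum big_imset /=; last by move=> *; apply: rev_ord_inj.
  rewrite -[X in X * c0]natz mulr_natl -sumr_const -sumrB.
  by apply: eq_bigr => c _; rewrite vertex_dual opprK subKr.
have [s _] := xP; have := sum_vertex n0 x (- t); rewrite s sJ => <-.
rewrite (bigID (mem J')) /= /vsum.
rewrite [X in _ = _ + X - _ + _](eq_bigl (fun c => c \in dualset J)) /=; first by ring.
by move=> c; rewrite finset.in_setC.
Qed.

End Fixed.
End TightSets.

(** * Raising one entry *)

Section RaisingMove.
Variables (n : nat) (m : nat -> int) (c0 : int).
Local Notation N := (2 * n)%N.
Hypothesis n0 : (0 < n)%N.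
Hypothesis m_anti : forall i j, (i <= j)%N -> m j <= m i.
Hypothesis m_dual : forall i : 'I_N, m i + m (rev_ord i) = c0.
Implicit Types (a b c i j : 'I_N) (k t : int) (J K : {set 'I_N}).

Let N0 : (0 < N)%N. Proof. by lia. Qed.

Variable x : extW N.
Hypotheses (xW : WGSp n x) (xP : permissible m x).

(* The entries indexed by F already have their final, largest values; D is the
   smallest tight set at t0 = - pos x a containing F and a, and b is the
   element of D outside F whose entry rises last before the entry of a does. *)
Variables (F D : {set 'I_N}) (a b : 'I_N) (q e : int).
Hypotheses (Ftight : forall t, tight m x t F)
  (Fconst : forall c t t', c \in F -> vertex x t c = vertex x t' c)
  (raF : rev_ord a \notin F)
  (Dtight : tight m x (- pos x a) D) (FD : F \subset D) (aD : a \in D)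
  (Ddual : forall c, c \in D -> rev_ord c \notin F)
  (Dmin : forall K, tight m x (- pos x a) K -> F \subset K -> a \in K ->
    K \subset D -> K = D)
  (bD : b \in D) (bF : b \notin F) (ba : b != a)
  (be : pos x b = pos x a + q * N%:Z + e) (e0 : 0 < e) (eN : e < N%:Z)
  (bmin : forall c (q' f : int), c \in D -> c \notin F -> c != a ->
    pos x c = pos x a + q' * N%:Z + f -> 0 <= f < N%:Z -> e <= f).

(** The gain of the a-th entry when [pos x a] grows by e: it is 1 on the e integers ending at - pos
    x a, modulo N, and 0 elsewhere. *)
Definition lift t : int := ceilz N (t + pos x a + e) - ceilz N (t + pos x a).

Lemma liftP t : lift t = 0 \/
  lift t = 1 /\ exists k r : int, t = - pos x a - r + k * N%:Z /\ 0 <= r < e.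
Proof.
have := ceilzP N0 (t + pos x a + e); have := ceilzP N0 (t + pos x a).
rewrite /lift; set p := ceilz N (t + pos x a); set p' := ceilz N _ => h1 h2.
have [p0|p1] : p' = p \/ p' = p + 1 by clear - h1 h2 e0 eN; nia.
  by left; rewrite p0 subrr.
right; split; first by rewrite p1; ring.
by exists p, (p * N%:Z - (t + pos x a)); split; [ring|clear - h1 h2 p1; nia].
Qed.

Lemma exists_mod (p p' : int) : exists k f : int, p = p' + k * N%:Z + f /\ 0 <= f < N%:Z.
Proof.
exists ((p - p') %/ N%:Z)%Z, ((p - p') %% N%:Z)%Z; split.
  by rewrite -addrA -divz_eq; ring.
by rewrite modz_ge0 ?ltz_pmod //; clear - N0; lia.
Qed.

(** By the choice of b, going back by r crosses no rise of x(omega_t) at a coordinate of D outside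
    F, while omega_t itself can only drop. *)
Lemma vertex_ge (r : int) c : 0 <= r < e -> c \in D ->
  vertex x (- pos x a) c <= vertex x (- pos x a - r) c.
Proof.
move=> re cD; have [cF|cF] := boolP (c \in F); first by rewrite (Fconst _ (- pos x a) cF).
have le : ceilz N (- pos x a - r - (c : nat)%:Z) <= ceilz N (- pos x a - (c : nat)%:Z).
  by apply: ceilz_le => //; clear - re; lia.
have [k [f [ck fN]]] := exists_mod (pos x c) (pos x a).
have eq : ceilz N (- pos x a - r + pos x c) = ceilz N (- pos x a + pos x c).
  have -> : - pos x a - r + pos x c = f - r + k * N%:Z by rewrite ck; ring.
  have -> : - pos x a + pos x c = f + k * N%:Z by rewrite ck; ring.
  rewrite !ceilz_shift //; congr (_ + _).
  have [ca|ca] := eqVneq c a.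
    have [_ f0] : k = 0 /\ f = 0.
      by apply: (small_mod _ fN); move: ck; rewrite ca; clear; lia.
    by rewrite f0 !ceilz_le0 //; clear - re eN N0; lia.
  have ef := bmin cD cF ca ck fN.
  by rewrite !ceilz_gt0 //; clear - re ef fN; lia.
by rewrite /vertex eq lerB.
Qed.

(** Going back, no entry over D decreases, and their sum over D, already equal to [cap], cannot
    increase. *)
Lemma vsum_eq (r : int) J : 0 <= r < e -> J \subset D ->
  vsum x (- pos x a - r) J = vsum x (- pos x a) J.
Proof.
move=> re JD.
have ge K : K \subset D -> vsum x (- pos x a) K <= vsum x (- pos x a - r) K.
  by move=> /fintype.subsetP KD; apply: ler_sum => c cK; apply: vertex_ge => //; apply: KD.
have split t : vsum x t D = vsum x t J + vsum x t (D :\: J).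
  by rewrite /vsum (big_setID J) /= (finset.setIidPr JD).
have [_ /(_ (- pos x a - r) D)] := xP; rewrite -(eqP Dtight) !split.
have := ge _ JD; have := ge _ (finset.subsetDl D J).
by move: (vsum _ _ _) (vsum _ _ _) (vsum _ _ _) (vsum _ _ _); clear; lia.
Qed.

Lemma tight_lift t J : lift t = 1 -> J \subset D -> tight m x t J = tight m x (- pos x a) J.
Proof.
case: (liftP t) => [-> //|[_ [k [r [-> re]]]] _ JD].
rewrite /tight -(vsum_eq re JD); congr (_ == _).
by apply: eq_bigr => c _; rewrite vertex_periodic.
Qed.

Lemma Dtight_lift t : lift t = 1 -> tight m x t D.
Proof. by move=> t1; rewrite tight_lift. Qed.

(** Otherwise (J :|: F) :&: D would be a tight set containing F and a, but strictly smaller than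
    D. *)
Lemma tight_mem t J : lift t = 1 -> tight m x t J -> a \in J -> b \in J.
Proof.
move=> t1 tJ aJ; have KD := finset.subsetIr (J :|: F) D.
have tK : tight m x t ((J :|: F) :&: D).
  apply: (tightI m_anti xP _ (Dtight_lift t1)).
  exact: (tightU m_anti xP).
rewrite tight_lift // in tK.
have := Dmin tK; rewrite finset.subsetI finset.subsetUr FD finset.inE finset.inE aJ aD => /(_ isT isT KD) KE.
by move: bD; rewrite -KE !finset.inE (negbTE bF) orbF => /andP [].
Qed.

Lemma vertex_gt t c : lift t = 1 -> c \in D -> c \notin F -> c != a ->
  m #|D|.-1 < vertex x t c.
Proof.
move=> t1 cD cF ca; rewrite ltNge; apply/negP => le.
have tD := Dtight_lift t1; have KD := finset.subsetDl D [set c]%SET.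
have tK : tight m x t (D :\ c).
  apply/eqP; have [_ /(_ t (D :\ c))] := xP.
  by have := eqP tD; rewrite (vsumD1 _ _ cD) (capD1 _ cD); clear - le; lia.
rewrite tight_lift // in tK.
have := Dmin tK; rewrite finset.subsetD1 FD cF finset.in_setD1 eq_sym ca aD => /(_ isT isT KD) KE.
by move: cD; rewrite -KE finset.setD11.
Qed.

Lemma tight_mem_rev t J :
  lift (- t) = 1 -> tight m x t J -> rev_ord b \in J -> rev_ord a \in J.
Proof.
move=> t1 tJ; apply: contraLR => raJ.
have := tight_mem t1 (tight_dual n0 m_dual xW xP tJ).
by rewrite !in_dualset; apply.
Qed.

Lemma pos_rev_similitude c : pos x (rev_ord c) = 1 - pos x c + (c0 - 1) * N%:Z.
Proof.
have [_ sW] := xW; have := similitude n0 m_dual xW xP c.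
rewrite /pos sW /= => <-; have := ltn_ord (finpart x c).
by move: (transl _ _ _) (transl _ _ _) => l l'; clear; nia.
Qed.

Lemma not_both t : lift t = 1 -> lift (- t) = 1 -> b != rev_ord a ->
  rev_ord a \in D -> rev_ord b \in D -> False.
Proof.
move=> t1 t1' bra raD rbD.
case: (liftP t) => [|[_ [k [r [tr re]]]]]; first by rewrite t1.
case: (liftP (- t)) => [|[_ [k' [r' [tr' re']]]]]; first by rewrite t1'.
have [u [f [fa fN]]] := exists_mod (pos x (rev_ord a)) (pos x a).
have [v [g [gb gN]]] := exists_mod (pos x (rev_ord b)) (pos x a).
have ef : e <= f by apply: (bmin raD raF (rev_neq a) fa).
have eg : e <= g.
  apply: (bmin rbD (Ddual bD) _ gb) => //.
  by rewrite rev_eqC.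
have sim c : pos x c + pos x (rev_ord c) = c0 * N%:Z - N%:Z + 1.
  by rewrite pos_rev_similitude; ring.
have sa := sim a; have sb := sim b; rewrite be in sb.
(* Modulo N, f is s and g is s - e, where s = 1 + r + r' lies between 1 and 2e - 1. So f < e if s <
   e, and g < e otherwise, contrary to [ef] and [eg]. *)
have E1 : f = 1 + r + r' + (c0 - 1 - k - k' - u) * N%:Z by clear - sa tr tr' fa; lia.
have E2 : g = 1 + r + r' - e + (c0 - 1 - k - k' - q - v) * N%:Z by clear - sa sb tr tr' gb; lia.
move: (c0 - 1 - k - k' - u) (c0 - 1 - k - k' - q - v) E1 E2 => U V E1 E2.
clear - E1 E2 re re' ef eg fN gN eN e0.
have [U1|[U0|U1]] : U <= -1 \/ U = 0 \/ 1 <= U by lia.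
- by nia.
- by rewrite U0 in E1; have [V1|V1] := lerP V 0; nia.
- by nia.
Qed.

(* The combined move is feasible at t although each half only uses up one unit
   of slack: a set J for which it fails would make D :|: J tight, so that
   rev a lies in D, and the values on D :\: J would be too large. *)
Lemma slack2 t J : lift t = 1 -> lift (- t) = 1 -> b != rev_ord a ->
  a \in J -> rev_ord b \in J -> b \notin J -> rev_ord a \notin J ->
  vsum x t J <= cap m J - 2.
Proof.
move=> t1 t1' bra aJ rbJ bJ raJ; have [_ le] := xP.
have tD := Dtight_lift t1; have eD := eqP tD.
have noJ : ~~ tight m x t J by apply/negP => tJ; rewrite (tight_mem t1 tJ aJ) in bJ.
have noI : ~~ tight m x t (J :&: D).
  apply/negP => tI; have := tight_mem t1 tI; rewrite !finset.inE aJ aD => /(_ isT).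
  by rewrite (negbTE bJ).
have := le t J; have := le t (J :&: D); have := le t (J :|: D).
rewrite /tight in noJ noI.
have ui := vsumUI x t J D; have cui := capUI m_anti J D.
move=> leU leI leJ; rewrite leNgt; apply/negP => gt.
(* J has slack 1 and J :&: D at least 1, so the submodular comparison consists of equalities and J
   :|: D has no slack. *)
have tU : tight m x t (J :|: D) by apply/eqP; clear - leU leI noJ noI ui cui leJ eD gt; lia.
have raD : rev_ord a \in D.
  have := tight_mem_rev t1' tU; rewrite !finset.inE rbJ => /(_ isT).
  by rewrite (negbTE raJ).
have rbD : rev_ord b \notin D by apply/negP => rbD; apply: (not_both t1 t1').
pose p := #|J :&: D|; pose d := #|D :\: J|.
have cD : #|D| = (p + d)%N by rewrite -(cardsID J D) /p finset.setIC.
have cU : #|J :|: D| = (#|J| + d)%N.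
  by rewrite -(cardsID J (J :|: D)) finset.setIUl finset.setIid finset.setDUl finset.setDv finset.set0U (finset.setUidPl _) ?finset.subsetIr.
have pJ : (p < #|J|)%N.
  apply: proper_card; rewrite properE finset.subsetIl; apply/negP => /fintype.subsetP /(_ _ rbJ).
  by rewrite finset.inE (negbTE rbD) andbF.
have eDJ : vsum x t D = vsum x t (J :&: D) + vsum x t (D :\: J).
  by rewrite /vsum (big_setID J) /= finset.setIC.
have bDJ : b \in D :\: J by rewrite finset.inE bJ bD.
have raDJ : rev_ord a \in D :\: J :\ b.
  by rewrite !finset.inE raJ raD eq_sym bra.
(* The 2 comes from b and rev a, whose entries strictly exceed the least value possible in D. *)
have lo : d%:Z * m #|D|.-1 + 2 <= vsum x t (D :\: J).
  set X := D :\: J :\ b :\ rev_ord a.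
  have -> : d = #|X|.+2 by rewrite /d (cardsD1 b) bDJ (cardsD1 (rev_ord a)) raDJ.
  have : #|X|%:Z * m #|D|.-1 <= vsum x t X.
    rewrite -[X in X * _]natz mulr_natl -sumr_const; apply: ler_sum => c.
    rewrite !finset.inE => /andP [_ /andP [_ /andP [_ cDD]]].
    exact: (tight_ge xP tD).
  rewrite (vsumD1 _ _ bDJ) (vsumD1 _ _ raDJ) -/X.
  have := vertex_gt t1 bD bF ba; have := vertex_gt t1 raD raF (rev_neq a).
  move: (m #|D|.-1) (vsum x t X) (vertex x t b) (vertex x t (rev_ord a)) #|X|.
  by clear => M V v w p; lia.
have s1 := topsum_shift m_anti d pJ; have s2 := topsum_slope m_anti p d.
have s3 := topsumS m (p + d)%N; have s4 := topsumS m p; rewrite addSn in s1.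
have d2 : (0 < d)%N by rewrite /d (cardsD1 b) bDJ.
have a1 : m (p + d)%N <= m #|D|.-1 by apply: m_anti; rewrite cD; clear - d2; lia.
have a2 : m #|D|.-1 <= m p by apply: m_anti; rewrite cD; clear - d2; lia.
have eU := eqP tU; have c1 : cap m D = topsum m (p + d) by rewrite /cap cD.
have c2 : cap m (J :|: D) = topsum m (#|J| + d) by rewrite /cap cU.
have c3 : cap m (J :&: D) = topsum m p by [].
have c4 : cap m J = topsum m #|J| by [].
rewrite c1 in eD cui; rewrite c2 in eU cui; rewrite c3 in noI leI cui.
rewrite c4 in gt leJ noJ cui.
(* Equality in the submodular bound with p < #|J| makes m constant from p to p + d; the sum over D
   :\: J is then at most d m_p + 1, contradicting [lo]. *)
have slope : d%:Z * m p <= d%:Z * m #|D|.-1.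
  apply: ler_wpM2l => //; clear - ui cui eD eU eDJ noI leI noJ leJ gt s1 s3 s4 a1.
  by lia.
clear - ui cui eD eU eDJ noI leI noJ leJ gt s2 lo slope.
by lia.
Qed.

Lemma ceilz_opp (z k : int) : ceilz N (1 - z + k * N%:Z) = 1 - ceilz N z + k.
Proof.
rewrite ceilz_shift // (_ : 1 - z = - (z - 1)); last by ring.
by rewrite ceilzN // subrK.
Qed.

Lemma wall_raise : wall x a b (- q) = - e.
Proof. by rewrite /wall be; ring. Qed.

(** Mirroring reverses t, so the mirror pair moves according to [lift (- t)]; when b = rev a the
    pair is its own mirror and moves once. *)
Lemma vertex_raise t c : vertex (refl a b (- q) * x)%g t c = vertex x t c
  + lift t * ((c == a)%:Z - (c == b)%:Z)
  + (if b == rev_ord a then 0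
     else lift (- t) * ((c == rev_ord b)%:Z - (c == rev_ord a)%:Z)).
Proof.
have ab : a != b by rewrite eq_sym.
rewrite /vertex pos_refl // wall_raise mulNr opprK addrA.
have ca : ceilz N (t + pos x a + e) = ceilz N (t + pos x a) + lift t.
  by rewrite /lift; ring.
have cb : ceilz N (t + pos x b - e) = ceilz N (t + pos x b) - lift t.
  have -> : t + pos x b - e = t + pos x a + q * N%:Z by rewrite be; ring.
  have -> : t + pos x b = t + pos x a + e + q * N%:Z by rewrite be; ring.
  by rewrite !ceilz_shift // ca; ring.
have [bra|bra] := eqVneq b (rev_ord a).
  have [->|cNa] := eqVneq c a.
    by rewrite coroot_l // mulr1 ca (negbTE ab) /=; ring.
  have [->|cNb] := eqVneq c b; first by rewrite coroot_r // mulrN1 cb /=; ring.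
  by rewrite corootE bra eqxx -bra (negbTE cNa) (negbTE cNb) subrr !mulr0 !addr0.
have cra : ceilz N (t + pos x (rev_ord a) - e) =
    ceilz N (t + pos x (rev_ord a)) - lift (- t).
  have -> : t + pos x (rev_ord a) - e = 1 - (- t + pos x a + e) + (c0 - 1) * N%:Z.
    by rewrite pos_rev_similitude; ring.
  have -> : t + pos x (rev_ord a) = 1 - (- t + pos x a) + (c0 - 1) * N%:Z.
    by rewrite pos_rev_similitude; ring.
  by rewrite !ceilz_opp /lift; ring.
have crb : ceilz N (t + pos x (rev_ord b) + e) =
    ceilz N (t + pos x (rev_ord b)) + lift (- t).
  have -> : t + pos x (rev_ord b) + e = 1 - (- t + pos x a) + (c0 - 1 - q) * N%:Z.
    by rewrite pos_rev_similitude be; ring.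
  have -> : t + pos x (rev_ord b) = 1 - (- t + pos x a + e) + (c0 - 1 - q) * N%:Z.
    by rewrite pos_rev_similitude be; ring.
  by rewrite !ceilz_opp /lift; ring.
have ra : (a == rev_ord a) = false by apply/negbTE; rewrite eq_sym rev_neq.
have rb : (b == rev_ord b) = false by apply/negbTE; rewrite eq_sym rev_neq.
have arb : (a == rev_ord b) = false by apply/negbTE; rewrite -rev_eqC eq_sym.
have [->|cNa] := eqVneq c a.
  by rewrite coroot_l // mulr1 ca (negbTE ab) ra arb /=; ring.
have [->|cNb] := eqVneq c b.
  by rewrite coroot_r // mulrN1 cb (negbTE bra) rb /=; ring.
have [->|cNra] := eqVneq c (rev_ord a).
  by rewrite coroot_rev // coroot_l // mulrN1 cra rev_eq (negbTE ab) /=; ring.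
have [->|cNrb] := eqVneq c (rev_ord b).
  by rewrite coroot_rev // coroot_r // opprK mulr1 crb /=; ring.
rewrite corootE (negbTE bra) (negbTE cNa) (negbTE cNb) (negbTE cNra) (negbTE cNrb).
by rewrite !subrr !mulr0 !addr0.
Qed.

Lemma vsum_raise t J : vsum (refl a b (- q) * x)%g t J = vsum x t J
  + lift t * ((a \in J)%:Z - (b \in J)%:Z)
  + (if b == rev_ord a then 0
     else lift (- t) * ((rev_ord b \in J)%:Z - (rev_ord a \in J)%:Z)).
Proof.
rewrite /vsum; under eq_bigr do rewrite vertex_raise.
rewrite !big_split /= -mulr_sumr sumrB !sum_mem; congr (_ + _).
case: ifP => _; first by rewrite big1.
by rewrite -mulr_sumr sumrB !sum_mem.
Qed.

(** A sum grows only over a set containing a raised entry without the matching lowered one. Such a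
    set is not tight by [tight_mem] or its dual, and [slack2] covers a simultaneous gain of 2. *)
Lemma permissible_raise : permissible m (refl a b (- q) * x)%g.
Proof.
split=> [|t J].
  have e' y : vsum y 0 [set: 'I_N]%SET = \sum_c transl y 0 c.
    by rewrite -(sum_vertex n0 y 0); apply: eq_bigl => c; rewrite finset.in_setT.
  have [<- _] := xP.
  by rewrite -!e' vsum_raise !finset.in_setT subrr !mulr0 if_same !addr0.
have [_ /(_ t J) le] := xP.
have l1 : lift t = 0 \/ lift t = 1 by case: (liftP t) => [|[]]; [left|right].
have l2 : lift (- t) = 0 \/ lift (- t) = 1.
  by case: (liftP (- t)) => [|[]]; [left|right].
have h1 : a \in J -> b \notin J -> vsum x t J + lift t <= cap m J.
  move=> aJ bJ; case: l1 => [->|t1]; first by rewrite addr0.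
  have : ~~ tight m x t J by apply: contra bJ => tJ; apply: (tight_mem t1 tJ).
  by rewrite /tight t1; clear - le; lia.
have h2 : rev_ord b \in J -> rev_ord a \notin J ->
    vsum x t J + lift (- t) <= cap m J.
  move=> bJ aJ; case: l2 => [->|t1]; first by rewrite addr0.
  have : ~~ tight m x t J by apply: contra aJ => tJ; apply: (tight_mem_rev t1 tJ).
  by rewrite /tight t1; clear - le; lia.
have h3 : b != rev_ord a -> a \in J -> b \notin J -> rev_ord b \in J ->
    rev_ord a \notin J -> vsum x t J + lift t + lift (- t) <= cap m J.
  move=> bra aJ bJ rbJ raJ; case: l1 => [->|t1]; first by rewrite addr0 h2.
  case: l2 => [->|t1']; first by rewrite addr0 h1.
  by have := slack2 t1 t1' bra aJ rbJ bJ raJ; rewrite t1 t1'; clear; lia.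
have {l1} l1 : 0 <= lift t by case: l1 => ->.
have {l2} l2 : 0 <= lift (- t) by case: l2 => ->.
rewrite vsum_raise; case: ifP => [_|/negbT bra].
  rewrite addr0; move: h1; clear h2 h3; case: (a \in J); case: (b \in J) => /= h1;
    by try move: (h1 isT isT); move: le l1; clear; lia.
move: (h3 bra) h1 h2; clear h3.
case: (a \in J); case: (b \in J); case: (rev_ord a \in J); case: (rev_ord b \in J);
  move=> /= h3 h1 h2; try move: (h1 isT isT); try move: (h2 isT isT);
  try move: (h3 isT isT isT isT); by move: le l1 l2; clear; lia.
Qed.

End RaisingMove.

(** * Choice of the reflection *)

Section PermissibleStep.
Variables (n : nat) (m : nat -> int) (c0 : int).
Local Notation N := (2 * n)%N.
Hypothesis n0 : (0 < n)%N.
Hypothesis m_anti : forall i j, (i <= j)%N -> m j <= m i.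
Hypothesis m_dual : forall i : 'I_N, m i + m (rev_ord i) = c0.
Implicit Types (a b c i j : 'I_N) (k t : int) (J K : {set 'I_N}).

Let N0 : (0 < N)%N. Proof. by lia. Qed.

Variable x : extW N.
Hypotheses (xW : WGSp n x) (xP : permissible m x).

(* The first r entries of the translation vector in the order given by g are
   already the r largest ones, and x only permutes the other coordinates. *)
Definition settled (g : 'S_N) (r : nat) : Prop :=
  forall j, (j < r)%N -> pos x (g j) + (g j : nat)%:Z = N%:Z * m j.

Lemma sum_ord_lt (f : nat -> int) r : (r <= N)%N ->
  \sum_(j < N | (j < r)%N) f j = \sum_(i < r) f i.
Proof. by move=> rN; rewrite [RHS](big_ord_widen N f rN). Qed.

Lemma card_ord_lt r : (r <= N)%N -> #|[set j : 'I_N | (j < r)%N]%SET| = r.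
Proof.
move=> rN; rewrite -sum1_card (eq_bigl (fun j : 'I_N => (j < r)%N)); last first.
  by move=> j; rewrite finset.inE.
by rewrite -(big_ord_widen N (fun=> 1%N) rN) sum1_card card_ord.
Qed.

Lemma settled_vertex g r j t : settled g r -> (j < r)%N -> vertex x t (g j) = m j.
Proof.
move=> gS jr; have e : pos x (g j) = m j * N%:Z - (g j : nat)%:Z by have := gS j jr; lia.
rewrite /vertex e (_ : t + _ = t - (g j : nat)%:Z + m j * N%:Z); last by ring.
by rewrite ceilz_shift //; ring.
Qed.

(** Either D exceeds F by a alone, and a becomes settled, or some other b in D gives the reflection
    of [permissible_raise]. *)
Lemma permissible_step (g : 'S_N) r : W0 g -> (r < n)%N -> settled g r ->
  (exists2 g', W0 g' & settled g' r.+1) \/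
  exists a b k, [/\ a != b, 0 < wall x a b k * wall 1%g a b k &
    permissible m (refl a b k * x)%g].
Proof.
move=> gW rn gS; have rN : (r < N)%N by lia.
pose F := [set g j | j in [set j : 'I_N | (j < r)%N]]%SET.
have gF j : (g j \in F) = (j < r)%N by rewrite mem_imset ?finset.inE //; apply: perm_inj.
have cF : #|F| = r by rewrite card_imset ?card_ord_lt ?(ltnW rN) //; apply: perm_inj.
have surj c : exists j, c = g j by exists (g^-1%g c); rewrite permKV.
have Fconst c t t' : c \in F -> vertex x t c = vertex x t' c.
  by have [j ->] := surj c; rewrite gF => jr; rewrite !(settled_vertex _ gS jr).
have Ftight t : tight m x t F.
  apply/eqP; rewrite /vsum /cap cF big_imset /=; last by move=> i j _ _; apply: perm_inj.
  rewrite /topsum -sum_ord_lt ?(ltnW rN) //; apply: eq_big => [j|j]; rewrite finset.inE //.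
  by move=> jr; rewrite (settled_vertex _ gS jr).
(* [T c] is the sum of [vertex x t c] over one period of t. *)
pose T c := pos x c + (c : nat)%:Z.
pose P := [pred c | (c \notin F) && (rev_ord c \notin F)].
have Pk : P (g (Ordinal rN)).
  by rewrite /= -gW !gF /= ltnn; lia.
have [a /andP [aF raF] amax] : exists2 a, P a & forall c, P c -> T c <= T a.
  by case: (arg_maxP T Pk) => a Pa amax; exists a.
pose good D := [&& tight m x (- pos x a) D, F \subset D & a \in D].
(* Searching for D inside the dual of F keeps D away from the mirror image of F. *)
have gd : good (dualset F).
  rewrite /good in_dualset raF andbT.
  have -> : tight m x (- pos x a) (dualset F) by apply: (tight_dual n0 m_dual xW xP).
  apply/fintype.subsetP => c; have [j ->] := surj c.
  by rewrite gF in_dualset -gW gF /= => jr; lia.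
have [D /finset.minsetP [/and3P [tD FD aD] Dmin'] /fintype.subsetP Ddual] := finset.minset_exists gd.
have Dmin K : tight m x (- pos x a) K -> F \subset K -> a \in K -> K \subset D -> K = D.
  by move=> tK FK aK KD; apply: Dmin' => //; apply/and3P.
have {}Ddual c : c \in D -> rev_ord c \notin F by move/Ddual; rewrite in_dualset.
have [/existsP [b0 b0P]|] := boolP [exists b, [&& b \in D, b \notin F & b != a]].
  right; pose Q b := [&& b \in D, b \notin F & b != a].
  pose f c := ((pos x c - pos x a) %% N%:Z)%Z.
  have [b /and3P [bD bF ba] bmin] : exists2 b, Q b & forall c, Q c -> f b <= f c.
    by case: (arg_minP (P := Q) f b0P) => b Pb bmin; exists b.
  pose q := ((pos x b - pos x a) %/ N%:Z)%Z.
  have be : pos x b = pos x a + q * N%:Z + f b.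
    by rewrite -addrA -divz_eq; ring.
  have fN c : 0 <= f c < N%:Z by rewrite modz_ge0 ?ltz_pmod //; clear - N0; lia.
  have e0 : 0 < f b.
    rewrite lt0r; case/andP: (fN b) => -> _; rewrite andbT.
    apply: contra ba => /eqP f0; apply/eqP; apply: (@pos_inj_mod _ x b a q).
    by rewrite be f0 addr0.
  have eN : f b < N%:Z by case/andP: (fN b).
  have bmin' c (q' e : int) : c \in D -> c \notin F -> c != a ->
      pos x c = pos x a + q' * N%:Z + e -> 0 <= e < N%:Z -> f b <= e.
    move=> cD cF' ca ce eb; have := bmin c; rewrite /Q cD cF' ca => /(_ isT).
    rewrite {2}/f (_ : pos x c - pos x a = q' * N%:Z + e); last by rewrite ce; ring.
    by rewrite modzMDl modz_small.
  exists a, b, (- q); split; first by rewrite eq_sym.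
    (* Maximality of [T a] makes the wall value at 1 negative, like the value - e at x; hence the
       reflection goes up. *)
    rewrite (wall_raise be) wall1; have : T b <= T a.
      by apply: amax; rewrite /= bF Ddual.
    rewrite /T be; clear - e0; nia.
  exact: (permissible_raise n0 m_anti m_dual xW xP Ftight Fconst raF tD FD
    aD Ddual Dmin bD bF ba be e0 eN bmin').
rewrite negb_exists => /forallP none; left.
have DE : D = a |: F.
  apply/eqP; rewrite finset.eqEsubset finset.subUset FD finset.sub1set aD !andbT.
  apply/fintype.subsetP => c cD; have := none c; rewrite cD !finset.inE.
  by case: (c \in F); case: (c == a).
have cD : cap m D = topsum m r + m r by rewrite /cap DE finset.cardsU1 aF cF add1n topsumS.
have vD t : vsum x t D = vertex x t a + topsum m r.
  have := eqP (Ftight t); rewrite /cap cF => <-.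
  by rewrite (vsumD1 _ _ aD) DE finset.setU1K.
(* Tightness at - pos x a makes the floor of T a / N equal to m r; the bound one step later makes
   its ceiling at most m r. *)
have Ta : T a = N%:Z * m r.
  have := eqP tD; have [_ /(_ (1 - pos x a) D)] := xP.
  rewrite cD !vD /vertex addNr subrK.
  rewrite (_ : 1 - pos x a - a%:Z = 1 - T a + 0 * N%:Z); last by rewrite /T; ring.
  rewrite ceilz_opp // (_ : - pos x a - a%:Z = - T a); last by rewrite /T; ring.
  have -> : ceilz N 1 = 1 by apply: ceilz_gt0; clear - N0; lia.
  have -> : ceilz N 0 = 0 by apply: ceilz_le0; clear - N0; lia.
  have := ceilzP N0 (T a); have := ceilzP N0 (- T a).
  by move: (T a) (ceilz _ _) (ceilz _ _) (m r) (topsum m r); clear; nia.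
(* The new permutation sends r to a and stays in [W0], without changing the values at settled
   indices. *)
exists (g * rperm (g (Ordinal rN)) a)%g => [c|j].
  by rewrite !permM gW rperm_rev.
rewrite ltnS leq_eqVlt permM => /orP [/eqP jr|jr].
  have -> : j = Ordinal rN by apply: val_inj.
  by rewrite rperm_l; exact: Ta.
rewrite rperm_d; first exact: gS.
- by rewrite (inj_eq perm_inj) -val_eqE /= gtn_eqF.
- by apply: contraNneq aF => ->; rewrite gF.
- by rewrite -gW (inj_eq perm_inj) -val_eqE /=; lia.
- by apply: contraNneq raF => ->; rewrite gF.
Qed.

End PermissibleStep.

(** * Permissible elements are admissible *)

Section PermissibleAdmissible.
Variables (R : realType) (n : nat) (m : nat -> int) (c0 : int) (mu : 'rV[int]_(2 * n)).
Local Notation N := (2 * n)%N.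
Hypothesis n0 : (0 < n)%N.
Hypothesis m_anti : forall i j, (i <= j)%N -> m j <= m i.
Hypothesis mu_m : forall i : 'I_N, mu 0 i = m i.
Hypothesis m_dual : forall i : 'I_N, m i + m (rev_ord i) = c0.
Implicit Types (x w t : extW N) (a b c i j : 'I_N) (k : int) (J K : {set 'I_N}).

Let N0 : (0 < N)%N. Proof. by lia. Qed.

(** The largest index in J is at least #|J| - 1, so its value is at most the last term of the top
    sum. *)
Lemma sum_le_topsum J : \sum_(c in J) m c <= topsum m #|J|.
Proof.
have [r] := ubnP #|J|; elim: r J => // r IH J Jr.
have [->|[c cJ]] := finset.set_0Vmem J; first by rewrite finset.cards0 big_set0 /topsum big_ord0.
have [i iJ imax] : exists2 i, i \in J & forall j, j \in J -> (j <= i)%N.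
  by case: (@arg_maxnP _ c (fun j => j \in J) (fun j : 'I_N => j : nat) cJ) => i; exists i.
have Ji : (#|J| <= i.+1)%N.
  rewrite -(card_ord_lt (ltn_ord i)); apply/subset_leq_card/fintype.subsetP => j jJ.
  by rewrite finset.inE ltnS imax.
have cJi := finset.cardsD1 i J; rewrite iJ add1n in cJi.
rewrite (big_setD1 i) //= cJi topsumS addrC; apply: lerD.
  by apply: IH; move: Jr; rewrite cJi.
by apply: m_anti; rewrite -ltnS -cJi.
Qed.

(** The sum over J is a linear form bounded by [cap] on the orbit of mu, hence on its hull;
    periodicity reduces t to the index of a vertex. *)
Lemma PermGL_permissible x : PermGL R mu x -> permissible m x.
Proof.
move=> [/WaffGL_translation s h].
have tot : \sum_c mu 0 c = topsum m N by apply: eq_bigr => c _.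
split; first by rewrite s tot.
move=> t J; have Nlt : ((t %% N%:Z)%Z < N%:Z) by apply: ltz_pmod; lia.
have Nge : 0 <= (t %% N%:Z)%Z by apply: modz_ge0; lia.
have [i ei] : exists i : 'I_N, (i : nat)%:Z = (t %% N%:Z)%Z.
  have iN : (`|(t %% N%:Z)%Z| < N)%N by lia.
  by exists (Ordinal iN); rewrite /= gez0_abs.
have -> : vsum x t J = vsum x (i : nat)%:Z J.
  apply: eq_bigr => c _; rewrite -[RHS](vertex_periodic n0 x _ (t %/ N%:Z)%Z).
  by rewrite ei addrC -divz_eq.
have := h i; apply: contraPT; rewrite -ltNge => lt.
move=> /(conv_hull_min (H := [set z : 'rV[R]_N |
  \sum_(c in J) z 0 c <= (cap m J)%:~R])) /= ct.
suff : \sum_(c in J) (aff_act x (omega R i) - omega R i) 0 c <= (cap m J)%:~R.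
  rewrite (eq_bigr (fun c => (vertex x (i : nat)%:Z c)%:~R)) -?rmorph_sum /= ?ler_int ?leNgt ?lt //.
  by move=> c _; rewrite mxE aff_actE !mxE vertex_ord // !(rmorphD, rmorphB, rmorphN) /=.
apply: ct => [u v r r0 r1 /= uH vH|_ [p _ <-]].
  under eq_bigr do rewrite !mxE.
  rewrite big_split /= -!mulr_sumr.
  have -> : (cap m J)%:~R = r * (cap m J)%:~R + (1 - r) * (cap m J)%:~R :> R by ring.
  by apply: lerD; apply: ler_wpM2l => //; lra.
rewrite /= (eq_bigr (fun c => (m (p c))%:~R)); last by move=> c _; rewrite !mxE mu_m.
rewrite -rmorph_sum ler_int /cap -(card_imset _ (@perm_inj _ p)).
have := sum_le_topsum [set p c | c in J]%SET.
by rewrite big_imset //= => i1 j1 _ _; apply: perm_inj.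
Qed.

(** The reflection is a word times an element of [Omega], which does not affect sides. Its wall
    separates the base alcove from its image, so the gallery of the word crosses it. *)
Lemma affrefl_cox a b k : a != b -> cox_reflection (@simple_refls n) (refl a b k).
Proof.
move=> ab; have rW := refl_WGSp k ab.
have [s [t [sS tW ts e]]] := alcove_decomposition rW.
have tO := OmegaP R n0 tW ts.
apply: (strong_exchange sS ab _).2.
rewrite -(Omega_sideM _ _ n0 tO ab) -e.
have := wall_refl k (@WGSp1 n) ab; rewrite mulg1 => ->.
by have := wall_neq0 1%g k ab; lia.
Qed.

Lemma gen_has_length w : gen (@simple_refls n) w ->
  exists l, has_length (@simple_refls n) w l.
Proof.
move=> /gen_expressible [l wl].
have ex : exists l, `[< expressible (@simple_refls n) w l >] by exists l; apply/asboolP.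
case: (ex_minnP ex) => k /asboolP wk kmin; exists k; split => // j wj.
by apply: kmin; apply/asboolP.
Qed.

(** The wall separates 1 from the reflected element, so [strong_exchange] turns a shortest word for
    the latter into a shorter one for w. *)
Lemma bruhat_step_refl w t a b k : Omega R t -> gen (@simple_refls n) w -> a != b ->
  0 < wall (w * t)%g a b k * wall 1%g a b k ->
  gen (@simple_refls n) (refl a b k * w)%g /\
  bruhat_step (@simple_refls n) w (refl a b k * w)%g.
Proof.
move=> tO wS ab sd; have [r [u [rS uS eu]]] := affrefl_cox k ab.
have wW := gen_simple_WGSp wS.
have vS : gen (@simple_refls n) (refl a b k * w)%g.
  apply: genM => //; rewrite eu; apply: genM; last exact: genV.
  by apply: genM => //; apply: gen_in.
split => //; have [k1 w1] := gen_has_length wS; have [k2 v2] := gen_has_length vS.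
exists (w^-1 * refl a b k * w)%g, k1, k2; split => //.
- exists r, (w^-1 * u)%g; split => //; first by apply: genM => //; apply: genV.
  by rewrite invgM invgK eu !mulgA.
- by rewrite !mulgA mulgV mul1g.
have [[s [sk sS es]] _] := v2.
have sd' : (0 < wall (\prod_(y <- s) y)%g a b k) != (0 < wall 1%g a b k).
  rewrite -es wall_refl //; have := Omega_sideM w k n0 tO ab.
  have := wall_neq0 w k ab; have := wall_neq0 1%g k ab; have := wall_neq0 (w * t)%g k ab.
  by move: sd; nia.
have [[s' [s'S ss' es']] _] := strong_exchange sS ab sd'.
have : (k1 <= size s')%N.
  by apply: w1.2; exists s'; split; rewrite // -es' -es mulgA reflK // mul1g.
by rewrite -sk ss'.
Qed.

(** The mirror relation settles the other n coordinates; residues modulo N then show that the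
    permutation part is trivial. *)
Lemma settled_translation x g : WGSp n x -> permissible m x -> W0 g ->
  settled m x g n -> exists2 s, W0 s & x = translation (col_perm s mu).
Proof.
move=> xW xP gW gS; exists (g^-1)%g.
  by move=> c; apply: (@perm_inj _ g); rewrite gW !permKV.
have gS' j : pos x (g j) + (g j : nat)%:Z = N%:Z * m j.
  have [/gS //|nj] := ltnP j n.
  have := gS (rev_ord j); rewrite gW (pos_rev_similitude n0 m_dual xW xP).
  have := m_dual j; have := ltn_ord (g j); rewrite /= => gN md h.
  have {}h := h ltac:(by have := ltn_ord j; clear - nj; lia).
  by move: (m j) (m _) md h => p q <-; nia.
have fix_c c : finpart x c = c /\ transl x 0 c = m (g^-1 c)%g.
  have := gS' (g^-1 c)%g; rewrite permKV /pos => h.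
  have [e1 e2] := @eq_ord_mod n (finpart x c) c (m (g^-1 c)%g - transl x 0 c)
    ltac:(by move: h; clear; lia).
  by split=> //; move: e2; clear; lia.
apply: extW_ext => c; have [fc tc] := fix_c c; last by rewrite fc /= perm1.
by rewrite tc /= mxE mu_m.
Qed.

Lemma permissible_raise_or_translation x : WGSp n x -> permissible m x ->
  (exists2 s, W0 s & x = translation (col_perm s mu)) \/
  exists a b k, [/\ a != b, 0 < wall x a b k * wall 1%g a b k &
    permissible m (refl a b k * x)%g].
Proof.
move=> xW xP.
have : forall r, (r <= n)%N -> (exists2 g, W0 g & settled m x g r) \/
    exists a b k, [/\ a != b, 0 < wall x a b k * wall 1%g a b k &
      permissible m (refl a b k * x)%g].
  elim=> [|r IH] rn; first by left; exists 1%g => // c; rewrite !perm1.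
  have [[g gW gS]|] := IH (ltnW rn); last by right.
  exact: (permissible_step n0 m_anti m_dual xW xP gW rn gS).
move=> /(_ n (leqnn n)) [[g gW gS]|]; last by right.
by left; apply: (settled_translation xW xP gW gS).
Qed.

(** At t = 1 - pos x c, just after a rise, the c-th entry is the ceiling of (pos x c + c) / N,
    bounded by m 0 through the singleton of c. *)
Lemma permissible_le x c : WGSp n x -> permissible m x ->
  pos x c + (c : nat)%:Z <= N%:Z * m 0%N.
Proof.
move=> xW [_ /(_ (1 - pos x c) [set c]%SET)].
rewrite /vsum /cap big_set1 finset.cards1 topsumS /topsum big_ord0 add0r /vertex subrK.
have -> : ceilz N 1 = 1 by apply: ceilz_gt0; clear - N0; lia.
rewrite (_ : 1 - _ - _ = 1 - (pos x c + (c : nat)%:Z) + 0 * N%:Z); last by ring.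
rewrite ceilz_opp //; have := ceilzP N0 (pos x c + (c : nat)%:Z).
by move: (pos x c + _) (m 0%N) (ceilz _ _); clear => p q r; nia.
Qed.

(** [permissible_le] at the mirror coordinate supplies a lower bound, so every term of the sum is
    bounded. *)
Lemma sqdist_bounded x : WGSp n x -> permissible m x ->
  sqdist x <= N%:Z * (N%:Z * (`|m 0%N| + `|c0|)) ^+ 2.
Proof.
move=> xW xP; rewrite -[X in X * _]natz mulr_natl -[in X in _ *+ X](card_ord N) -sumr_const.
apply: ler_sum => c _; have := permissible_le c xW xP.
have := permissible_le (rev_ord c) xW xP.
rewrite (pos_rev_similitude n0 m_dual xW xP) /=; have := ltn_ord c.
move: (pos x c) (m 0%N) (nat_of_ord c) => p q r rN h1 h2.
have {}h1 : N%:Z * c0 - (p + r%:Z) <= N%:Z * q by clear - h1 rN; lia.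
rewrite -[(p + _) ^+ 2]real_normK ?num_real // ler_pXn2r ?nnegrE ?mulr_ge0 //.
by clear - h1 h2 N0; move: (p + r%:Z) h1 h2 => s h1 h2; nia.
Qed.

(** Each upward reflection raises [sqdist], which stays below B, so the ascent ends at a translation
    in the orbit. *)
Lemma permissible_bruhat w t : Omega R t -> gen (@simple_refls n) w ->
  permissible m (w * t)%g ->
  exists s w', [/\ W0 s, gen (@simple_refls n) w',
    (w' * t)%g = translation (col_perm s mu) & bruhat (@simple_refls n) w w'].
Proof.
move=> tO; set B := N%:Z * (N%:Z * (`|m 0%N| + `|c0|)) ^+ 2.
have [r] := ubnP `|B - sqdist (w * t)%g|%N; elim: r w => // r IH w lt wS wP.
have wtW : WGSp n (w * t)%g.
  by apply: WGSpM; [apply: gen_simple_WGSp|case: tO].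
have [[s sW e]|[a [b [k [ab sd P]]]]] := permissible_raise_or_translation wtW wP.
  by exists s, w; split => //; apply: rt_refl.
have [vS st] := bruhat_step_refl tO wS ab sd; rewrite mulgA in P.
have [|s [w' [sW w'S e le]]] := IH _ _ vS P.
  have := sqdist_bounded wtW wP.
  have vW : WGSp n (refl a b k * w * t)%g.
    by apply: WGSpM; [apply: gen_simple_WGSp|case: tO].
  have := sqdist_bounded vW P; have [c cp] := sqdist_refl k wtW ab.
  rewrite mulgA => ->; rewrite -/B; clear IH; move: lt sd cp.
  by move: (wall _ _ _ _ * _) (sqdist _) B => p q BB; clear; nia.
by exists s, w'; split => //; apply: rt_trans le; apply: rt_step.
Qed.

Lemma PermGL_AdmGSp x : WGSp n x -> PermGL R mu x -> AdmGSp R mu x.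
Proof.
move=> xW /PermGL_permissible xP.
have [s [t [sS tW ts e]]] := alcove_decomposition xW.
have tO := OmegaP R n0 tW ts; have wS := gen_prod sS.
rewrite e in xP; have [p [w' [pW w'S ew' le]]] := permissible_bruhat tO wS xP.
split => //; exists p => //; exists (\prod_(y <- s) y)%g, w', t.
by split => //; [split; apply: gen_simple_Waff|rewrite SaffE].
Qed.

End PermissibleAdmissible.

(** * Dominant coweights and the final equality *)

Lemma dominant_anti n (mu : 'rV[int]_(2 * n)) (i j : 'I_(2 * n)) :
  Xstar mu -> dominant mu -> (i <= j)%N -> mu 0 j <= mu 0 i.
Proof.
move=> muX mud; have succ (u v : 'I_(2 * n)) : v = u.+1 :> nat -> mu 0 v <= mu 0 u.
  move=> uv; have [un|nu] := ltnP u n.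
    by rewrite -subr_ge0; apply: mud.
  have sr : simple_root (rev_ord v) (rev_ord u).
    by split=> /=; have := ltn_ord v; lia.
  have := mud _ _ sr; have := muX u v; rewrite /root_pairing subr_ge0.
  rewrite -[_ <= mu 0 u]subr_ge0 -[_ <= mu 0 (rev_ord v)]subr_ge0.
  by move: (mu _ _) (mu _ _) (mu _ _) (mu _ _) => p q r s; lia.
have le d (v : 'I_(2 * n)) : v = (i + d)%N :> nat -> mu 0 v <= mu 0 i.
  elim: d v => [|d IH] v e; first by move: e; rewrite addn0 => /val_inj ->.
  have hl : (i + d < 2 * n)%N by have := ltn_ord v; lia.
  by apply: le_trans (IH (Ordinal hl) _); rewrite //=; apply: succ; rewrite /= e; lia.
by move=> ij; apply: (@le (j - i)%N); lia.
Qed.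

Theorem proposition5 (R : realType) (n : nat) (hn : (0 < n)%N)
    (mu : 'rV[int]_(2 * n)) (hmu : Xstar mu) (hdom : dominant mu) :
  AdmGSp R mu = PermGL R mu `&` WGSp n.
Proof.
apply/seteqP; split=> [x xA|x [xP xW]].
  by split; [apply: AdmGSp_PermGL|case: xA].
have N0 : (0 < 2 * n)%N by lia.
(* Indices past the end are sent to the last one, which extends mu to a nonincreasing function on
   all natural numbers. *)
have ltN j : (minn j (2 * n).-1 < 2 * n)%N by lia.
pose m j := mu 0 (Ordinal (ltN j)).
have mu_m (i : 'I_(2 * n)) : mu 0 i = m i.
  by congr (mu 0 _); apply: val_inj; have := ltn_ord i; rewrite /=; lia.
have m_anti i j : (i <= j)%N -> m j <= m i.
  move=> ij; apply: dominant_anti => //.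
  by rewrite leq_min geq_minr (leq_trans (geq_minl _ _) ij).
pose o := Ordinal N0.
apply: (PermGL_AdmGSp (c0 := mu 0 o + mu 0 (rev_ord o)) hn m_anti mu_m _ xW xP).
by move=> i; rewrite -!mu_m; apply: hmu.
Qed.
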